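(* Let $I\subset\mathbb{R}$ be an open interval containing $0$, let $a>0$, and let $b,c:I\to(0,\infty)$ be smooth functions. Put $$A_1(\lambda)=A_3(\lambda)=\begin{bmatrix}-a & b(\lambda)\\ -c(\lambda) & -a\end{bmatrix},\qquad A_2(\lambda)=A_4(\lambda)=\begin{bmatrix}-a & c(\lambda)\\ -b(\lambda) & -a\end{bmatrix},$$ and for $i=1,2,3,4$ let $f_i(x,\lambda)=A_i(\lambda)x+\bar f_i(x,\lambda)$ for $(x,\lambda)\in\mathbb{R}^2\times I$, where $\bar f_i:\mathbb{R}^2\times I\to\mathbb{R}^2$ is analytic and $\bar f_i(x,\lambda)=o(\|x\|)$ as $x\to 0$. Consider the switched system $$\dot x=f_i(x,\lambda)\quad\text{for } x\in S_i,\qquad i=1,2,3,4,$$ with the regions $S_1,\dots,S_4$ given in the context. Define $$\Delta(\lambda)=\left(\frac{b(\lambda)}{c(\lambda)}\right)^2 e^{-\frac{a}{\sqrt{b(\lambda)c(\lambda)}}\cdot 2\pi},\qquad \lambda\in I,$$ and suppose that $$\Delta(0)=1,\qquad \left.\frac{d\Delta(\lambda)}{d\lambda}\right|_{\lambda=0}\neq 0.$$ Then there are an open interval $\bar I\subset\mathbb{R}$ with $0\in\bar I$ and a continuous function $\bar\lambda:\bar I\to I$ satisfying $\bar\lambda(0)=0$ such that for each $x_1\in\bar I$ there is a periodic orbit of the switched system with parameter value $\lambda=\bar\lambda(x_1)$ passing through the point $(x_1,0)$ (for $x_1=0$ this orbit is the equilibrium at the origin).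
   Context: Write $x=(x_1,x_2)^T\in\mathbb{R}^2$. The regions are $S_1=\{0<x_1<\infty,\ x_2\ge 0\}$, $S_2=\{-\infty<x_1\le 0,\ x_2>0\}$, $S_3=\{-\infty<x_1<0,\ x_2\le 0\}$, $S_4=\{0\le x_1<\infty,\ x_2<0\}$, so that $\mathbb{R}^2=S_1\cup S_2\cup S_3\cup S_4\cup\{(0,0)\}$. The origin is an equilibrium. A solution is a continuous curve $x(t)$ which follows the vector field $f_i(\cdot,\lambda)$ while $x(t)\in S_i$, the switching from one subsystem to another taking place when $x(t)$ crosses a half coordinate axis (so the differential equation holds except possibly at the isolated crossing times). *)

(* Defs.v *)
From mathcomp Require Import all_boot all_order all_algebra.
From mathcomp Require Import all_classical all_reals all_analysis.

Set Implicit Arguments.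
Unset Strict Implicit.
Unset Printing Implicit Defensive.

Import Order.TTheory GRing.Theory Num.Theory.
Import numFieldNormedType.Exports.

Local Open Scope classical_set_scope.
Local Open Scope ring_scope.

Definition col2 (R : realType) (u v : R) : 'cV[R]_2 :=
  \col_(i < 2) if i == 0 then u else v.

Definition mx22 (R : realType) (m00 m01 m10 m11 : R) : 'M[R]_2 :=
  \matrix_(i < 2, j < 2)
    if i == 0 then (if j == 0 then m00 else m01)
    else (if j == 0 then m10 else m11).

(* A function on an interval is represented by a total function of which only
   the values on the interval matter. *)
Definition open_interval_around0 (R : realType) (I : set R) : Prop :=
  [/\ open I, is_interval I & I 0].

Definition smooth_on (R : realType) (I : set R) (g : R -> R) : Prop :=
  forall (n : nat) (l : R), I l -> derivable (derive1n n g) l 1.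

(* Joint real analyticity in the three variables (x_1, x_2, l): near (p, l),
   g is the sum of an absolutely convergent triple power series.  For
   nonnegative terms, convergence of the sums over the cubes {0..N-1}^3 is
   summability. *)
Definition analytic_at (R : realType) (g : 'cV[R]_2 -> R -> 'cV[R]_2)
    (p : 'cV[R]_2) (l : R) : Prop :=
  exists (c : nat -> nat -> nat -> 'cV[R]_2) (r : R), 0 < r /\
  forall (h : 'cV[R]_2) (m : R), `|h| < r -> `|m| < r ->
    let term i j k := (h 0 0 ^+ i * h 1 0 ^+ j * m ^+ k) *: c i j k in
    cvgn (fun N : nat =>
      \sum_(i < N) \sum_(j < N) \sum_(k < N) `|term i j k|) /\
    (fun N : nat => \sum_(i < N) \sum_(j < N) \sum_(k < N) term i j k)
      @ \oo --> g (p + h) (l + m).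

Variant quadrant := Q1 | Q2 | Q3 | Q4.

Definition region (R : realType) (i : quadrant) : set 'cV[R]_2 :=
  match i with
  | Q1 => [set x | 0 < x 0 0 /\ 0 <= x 1 0]
  | Q2 => [set x | x 0 0 <= 0 /\ 0 < x 1 0]
  | Q3 => [set x | x 0 0 < 0 /\ x 1 0 <= 0]
  | Q4 => [set x | 0 <= x 0 0 /\ x 1 0 < 0]
  end.

Definition Amx (R : realType) (a : R) (b c : R -> R) (i : quadrant) (l : R) :
    'M[R]_2 :=
  match i with
  | Q1 | Q3 => mx22 (- a) (b l) (- c l) (- a)
  | Q2 | Q4 => mx22 (- a) (c l) (- b l) (- a)
  end.

Definition subsystem (R : realType) (a : R) (b c : R -> R)
    (fbar : quadrant -> 'cV[R]_2 -> R -> 'cV[R]_2) (l : R)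
    (i : quadrant) (x : 'cV[R]_2) : 'cV[R]_2 :=
  Amx a b c i l *m x + fbar i x l.

Definition Delta (R : realType) (a : R) (b c : R -> R) (l : R) : R :=
  (b l / c l) ^+ 2 * expR (- (a / Num.sqrt (b l * c l)) * (2 * pi)).

(* By continuity of x, a point x t <> 0 at which the region changes lies on the
   half coordinate axis separating the two regions. *)
Definition crossing_time (R : realType) (x : R -> 'cV[R]_2) (t : R) : Prop :=
  x t != 0 /\
  exists i j : quadrant, [/\ i <> j,
    \forall s \near t^'-, region i (x s) &
    \forall s \near t^'+, region j (x s)].

(* The origin, which lies in no region, is an equilibrium. *)
Definition follows_field (R : realType) (f : quadrant -> 'cV[R]_2 -> 'cV[R]_2)
    (x : R -> 'cV[R]_2) (t : R) : Prop :=
  (forall i : quadrant, region i (x t) -> is_derive t 1 x (f i (x t))) /\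
  (x t = 0 -> is_derive t 1 x 0).

Definition switched_solution (R : realType)
    (f : quadrant -> 'cV[R]_2 -> 'cV[R]_2) (x : R -> 'cV[R]_2) : Prop :=
  [/\ continuous x,
      forall u v : R, finite_set (`[u, v] `&` crossing_time x) &
      forall t : R, ~ crossing_time x t -> follows_field f x t].

Definition periodic_solution (R : realType)
    (f : quadrant -> 'cV[R]_2 -> 'cV[R]_2) (x : R -> 'cV[R]_2) : Prop :=
  switched_solution f x /\
  exists T : R, 0 < T /\ forall t : R, x (t + T) = x t.

(* Main.v *)
(** Rotating the quadrant [q] onto the fourth one conjugates every linear part
  to the same matrix.  In polar coordinates adapted to that matrix the angle
  advances at speed close to [sqrt (b c)], so it may serve as the independent
  variable, and the logarithm of the radius solves a scalar equation whose
  dependence on the radius [r] and on the parameter [l] is Lipschitz with a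
  constant of order [r] in [l]; this is where the joint analyticity of the
  perturbation and its flatness at the origin enter.  Hence crossing one
  quadrant multiplies the radius by [exp (D l + e r l)] with
  [D = ln (sqrt (b / c)) - a / sqrt (b c) * pi / 2] and [e] Lipschitz with
  constants [O(1)] in [r] and [O(r)] in [l].  A turn through the four quadrants
  multiplies it by [exp (4 D l + e' r l)], where [exp (4 D) = Delta].  Since
  [4 D] is strictly differentiable at [0] with nonzero derivative, the equation
  [4 D l + e' r l = 0] has a solution [l] that is a Lipschitz function of [r].
  Negative abscissas are treated by starting the turn in the second quadrant. *)

Require Import Defs.
From mathcomp Require Import all_boot all_order all_algebra.
From mathcomp Require Import all_classical all_reals all_analysis.
From mathcomp Require Import ring lra.

Set Implicit Arguments.
Unset Strict Implicit.
Unset Printing Implicit Defensive.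

Import Order.TTheory GRing.Theory Num.Theory.
Import numFieldNormedType.Exports.

Local Open Scope classical_set_scope.
Local Open Scope ring_scope.

(** * Scalar differential equations *)

(** The return map is never differentiated. Its displacement vanishes identically at [r = 0], so the
    implicit function theorem does not apply to it directly; writing each passage as multiplication
    of the radius by an exponential divides out this trivial zero, at the price of estimates for
    quotients by [r] down to [r = 0]. Lipschitz bounds on these quotients suffice: an intermediate
    value argument finds the parameter, and the slope of [4 D] dominates the Lipschitz constant of
    [e'] in [l], which makes the parameter unique and Lipschitz in [r]. A constant of size [O(1)] in
    [l] could not be beaten by that slope, which is why two classes of functions, [lip] and [slip],
    are kept apart. Existence and dependence of the solutions come from a Picard scheme on the angle
    interval [[0, 2]], which contains [[0, pi / 2]]; it contracts because the radius is small, not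
    because the interval is. Switching does not enter these estimates: each quadrant is crossed
    under a single field, and the arcs are glued afterwards. *)

Lemma is_derive_continuous (R : realType) (f : R -> R) (x d : R) :
  is_derive x 1 f d -> {for x, continuous f}.
Proof. by move=> [fx _]; apply/differentiable_continuous/derivable1_diffP. Qed.

Lemma mvt_bound (R : realType) (f df : R -> R) (a b K : R) : a <= b ->
  {within `[a, b], continuous f} ->
  (forall x, a < x < b -> is_derive x 1 f (df x)) ->
  (forall x, a < x < b -> `|df x| <= K) ->
  `|f b - f a| <= K * (b - a).
Proof.
rewrite le_eqVlt => /predU1P[-> _ _ _|ab fc fd dK].
  by rewrite !subrr normr0 mulr0.
have fd' x : x \in `]a, b[ -> is_derive x 1 f (df x) by rewrite in_itv => /fd.
have [c + ->] := MVT ab fd' fc.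
rewrite in_itv/= => cab; rewrite normrM (gtr0_norm (_ : 0 < b - a)) ?subr_gt0//.
by rewrite ler_wpM2r ?subr_ge0 ?(ltW ab) ?dK.
Qed.

Lemma primitive_oo (R : realType) (f : R -> R) (N : R) :
  continuous f -> 0 < N ->
  exists F : R -> R, F 0 = 0 /\ forall x : R, - N < x < N -> is_derive x 1 F (f x).
Proof.
move=> fc N0.
pose mu := @lebesgue_measure R.
pose G x := (\int[mu]_(t in `[- N, x]) f t)%R.
exists (fun x => G x - G 0); split; first by rewrite subrr.
move=> x /andP[Nx xN].
have fi : mu.-integrable `[- N, N] (EFin \o f).
  apply: continuous_compact_integrable; first exact: segment_compact.
  exact: continuous_subspaceT.
have [dG GE] := @continuous_FTC1_closed _ f (- N) x N xN fi Nx (fc x).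
rewrite -[f x]subr0; apply: is_deriveB; rewrite -GE derive1E.
exact: derivableP.
Qed.

(** Primitives on growing intervals, all normalized to vanish at [0], agree on the smaller interval
    because their difference has derivative zero; they therefore glue. *)
Lemma primitive (R : realType) (f : R -> R) : continuous f ->
  exists F : R -> R, F 0 = 0 /\ forall x : R, is_derive x 1 F (f x).
Proof.
move=> fc.
have /choice[F FP] (n : nat) : exists F : R -> R,
    F 0 = 0 /\ forall x : R, - n.+1%:R < x < n.+1%:R -> is_derive x 1 F (f x).
  exact: primitive_oo.
have F_eq n m (x : R) : (n <= m)%N -> `|x| < n.+1%:R -> F n x = F m x.
  move=> nm xn.
  have nmR : n.+1%:R <= m.+1%:R :> R by rewrite ler_nat.
  have d0 (y : R) : `|y| <= `|x| -> is_derive y 1 (F n \- F m) 0.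
    move=> yx; have yn := le_lt_trans yx xn.
    rewrite -(subrr (f y)); apply: is_deriveB; apply: (FP _).2; rewrite -ltr_norml//.
    exact: lt_le_trans nmR.
  have c0 (a b : R) : `|a| <= `|x| -> `|b| <= `|x| ->
      {within `[a, b], continuous (F n \- F m)}.
    move=> ax bx; apply: derivable_within_continuous => y; rewrite in_itv/=.
    move=> /andP[ay yb]; have [] := d0 y => //.
    by rewrite ler_norml (le_trans _ ay) ?(le_trans yb)//;
      move: ax bx; rewrite !ler_norml => /andP[] + + /andP[].
  suff : `|(F n \- F m) x - (F n \- F m) 0| <= 0.
    by rewrite normr_le0 /= !(FP _).1 !subr0 subr_eq0 => /eqP.
  have [x0|x0] := leP 0 x.
    have := @mvt_bound R (F n \- F m) (fun=> 0) 0 x 0; rewrite mul0r; apply => //.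
    - by apply: c0; rewrite ?normr0.
    - move=> y /andP[y0 yx]; apply: d0.
      by rewrite !ger0_norm// ltW.
    - by move=> *; rewrite normr0.
  have := @mvt_bound R (F n \- F m) (fun=> 0) x 0 0.
  rewrite mul0r distrC; apply => //; first exact: ltW.
  - by apply: c0; rewrite ?normr0.
  - move=> y /andP[y0 yx]; apply: d0.
    by rewrite !ltr0_norm// lerN2 ltW.
  - by move=> *; rewrite normr0.
pose n (x : R) := Num.truncn `|x|.
exists (fun x => F (n x) x); split; first exact: (FP _).1.
move=> x.
have nP : `|x| < (n x).+1%:R by rewrite truncnS_gt.
apply: (@near_eq_is_derive _ _ _ (F (n x).+1)); last first.
  by apply: (FP _).2; rewrite -ltr_norml (lt_trans nP)// ltr_nat.
near=> y.
have yn : `|y| < (n x).+1%:R.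
  by near: y; apply: (@cvgr_lt _ _ _ _ _ `|x|) => //; exact: norm_continuous.
symmetry; apply: F_eq; last by rewrite /n truncnS_gt.
by rewrite leqW// /n truncn_le_nat.
Unshelve. all: by end_near. Qed.

Lemma lipschitz_cts (R : realType) (f : R -> R) (K : R) :
  (forall x y, `|f x - f y| <= K * `|x - y|) -> continuous f.
Proof.
move=> fK x; apply/cvgrPdist_le => e e0; near=> y.
have K0 : 0 < `|K| + 1 by rewrite ltr_wpDl.
apply: le_trans (fK _ _) _.
apply: (@le_trans _ _ ((`|K| + 1) * `|x - y|)).
  by rewrite ler_wpM2r// (le_trans (ler_norm _))// lerDl.
rewrite -ler_pdivlMl//; near: y; apply: cvgr_dist_le => //.
by rewrite mulr_gt0 ?invr_gt0.
Unshelve. all: by end_near. Qed.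

Definition clamp (R : realType) (a b x : R) : R := Num.max a (Num.min b x).

Lemma clamp_itv (R : realType) (a b x : R) : a <= b -> a <= clamp a b x <= b.
Proof. by move=> ab; rewrite /clamp le_max lexx ge_max ab ge_min lexx. Qed.

Lemma clamp_id (R : realType) (a b x : R) : a <= x <= b -> clamp a b x = x.
Proof. by move=> /andP[ax xb]; rewrite /clamp min_r// max_r. Qed.

Lemma clamp_lip (R : realType) (a b x y : R) :
  `|clamp a b x - clamp a b y| <= `|x - y|.
Proof.
wlog xy : x y / x <= y => [wl|].
  have [/wl//|/ltW yx] := leP x y.
  by rewrite distrC (distrC x); exact: wl.
have cxy : clamp a b x <= clamp a b y by rewrite /clamp le_max2// le_min2.
rewrite distrC (distrC x) !ger0_norm ?subr_ge0// /clamp.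
case: (leP b x) => ?; case: (leP b y) => ?; rewrite /Order.max;
  do ![case: ifPn; rewrite -?leNgt => ?]; lra.
Qed.

(** Inequalities for a Picard limit are proved at every iterate with a geometric error, which is
    removed here; no topology on a function space is involved. *)
Lemma le_add_geo (R : realType) (x y c : R) :
  (forall k : nat, x <= y + c / 2 ^+ k) -> x <= y.
Proof.
move=> H; rewrite leNgt; apply/negP => yx.
have e0 : 0 < x - y by rewrite subr_gt0.
pose k := Num.truncn (`|c| / (x - y)).
have := truncnS_gt (`|c| / (x - y)); rewrite -/k ltr_pdivrMr// => ck.
have k2 : k.+1%:R <= 2 ^+ k :> R by rewrite -natrX ler_nat ltn_expl.
have := H k; rewrite -lerBlDl ler_pdivlMr ?exprn_gt0// leNgt => /negP; apply.
apply: le_lt_trans (ler_norm _) _; apply: lt_le_trans ck _.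
by rewrite mulrC ler_wpM2l// ltW.
Qed.

Lemma le_add_geo0 (R : realType) (x c : R) :
  (forall k : nat, x <= c / 2 ^+ k) -> x <= 0.
Proof. by move=> H; apply: (@le_add_geo _ _ _ c) => k; rewrite add0r. Qed.

(** The intervals [[u k - e k, u k + e k]] are nested, since [e k - e k.+1] is the allowed jump. The
    supremum of their left ends is the limit, with an explicit error at every index. *)
Lemma geo_limit (R : realType) (u : nat -> R) (c : R) :
  (forall k, `|u k.+1 - u k| <= c / 2 ^+ k) ->
  exists l, forall k, `|l - u k| <= 2 * c / 2 ^+ k.
Proof.
move=> uc.
pose e (k : nat) : R := 2 * c / 2 ^+ k.
have eS k : e k - e k.+1 = c / 2 ^+ k.
  have k0 : (2 : R) ^+ k != 0 by rewrite expf_neq0.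
  by rewrite /e exprS; field.
have c0 : 0 <= c by have := le_trans (normr_ge0 _) (uc 0%N); rewrite expr0 divr1.
have e0 k : 0 <= e k by rewrite /e divr_ge0// ?mulr_ge0 ?exprn_ge0.
have up i j : (i <= j)%N -> u j + e j <= u i + e i.
  move=> /subnK <-; elim: (j - i)%N => // k IH; apply: le_trans IH.
  by have := uc (k + i)%N; rewrite -eS ler_norml addSn => /andP[]; lra.
have down i j : (i <= j)%N -> u i - e i <= u j - e j.
  move=> /subnK <-; elim: (j - i)%N => // k IH; apply: (le_trans IH).
  by have := uc (k + i)%N; rewrite -eS ler_norml addSn => /andP[]; lra.
have ud i j : u i - e i <= u j + e j.
  have := down i (maxn i j) (leq_maxl _ _); have := up j (maxn i j) (leq_maxr _ _).
  by have := e0 (maxn i j); lra.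
pose A := [set x | exists k, x = u k - e k].
have Aub j : ubound A (u j + e j) by move=> _ [k ->].
exists (sup A) => k; rewrite ler_norml; apply/andP; split.
- have : u k - e k <= sup A.
    apply: ub_le_sup; first by exists (u 0%N + e 0%N).
    by exists k.
  by rewrite /e; lra.
- have : sup A <= u k + e k.
    by apply: ge_sup; [exists (u 0%N - e 0%N), 0%N|].
  by rewrite /e; lra.
Qed.

(** A field that is [1/4]-Lipschitz in [y], over a time interval of length [2], makes the integral
    operator halve distances, which matches [geo_limit]. Continuity of the field is asked only along
    continuous curves, the form in which it is available for the angular equation. *)
Lemma picard (R : realType) (h : R -> R -> R) (B : R)
    (hc : forall y, continuous y -> continuous (fun t => h t (y t)))
    (hB : forall t y, `|h t y| <= B)
    (hl : forall t y z, `|h t y - h t z| <= 4^-1 * `|y - z|) :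
  exists n : R -> R, [/\ continuous n, n 0 = 0, forall t, `|n t| <= 2 * B &
    forall t : R, 0 < t < 2 -> is_derive t 1 n (h t (n t))].
Proof.
have B0 : 0 <= B := le_trans (normr_ge0 _) (hB 0 0).
have /choice[prim primP] : forall f : R -> R, exists F : R -> R,
    continuous f -> F 0 = 0 /\ forall x : R, is_derive x 1 F (f x).
  move=> f; have [fc|nfc] := pselect (continuous f).
    by have [F FP] := primitive fc; exists F.
  by exists f.
pose P (y : R -> R) := prim (fun t => h t (y t)).
(* Clamping the time freezes each iterate outside [[0, 2]], so that all bounds hold on the whole
   line. *)
pose S y t := P y (clamp 0 2 t).
have c02 (t : R) : 0 <= clamp 0 2 t <= 2 by apply: clamp_itv.
have Pd (y : R -> R) : continuous y -> forall t : R, is_derive t 1 (P y) (h t (y t)).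
  by move=> /hc/primP[].
have P0 (y : R -> R) : continuous y -> P y 0 = 0 by move=> /hc/primP[].
have Pc (y : R -> R) : continuous y -> continuous (P y).
  by move=> yc t; exact: is_derive_continuous (Pd _ yc t).
have Slip (y : R -> R) : continuous y -> forall s t, `|S y s - S y t| <= B * `|s - t|.
  move=> yc s t; apply: (@le_trans _ _ (B * `|clamp 0 2 s - clamp 0 2 t|));
    last by rewrite ler_wpM2l// clamp_lip.
  rewrite /S; move: (clamp 0 2 s) (clamp 0 2 t) => {}s {}t.
  wlog st : s t / s <= t => [wl|].
    have [/wl//|/ltW ts] := leP s t.
    by rewrite distrC (distrC s); exact: wl.
  rewrite distrC (distrC s) (ger0_norm (_ : 0 <= t - s)) ?subr_ge0//.
  apply: (@mvt_bound _ _ (fun t => h t (y t))) => //.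
    by apply: continuous_subspaceT; exact: Pc.
  by move=> x _; exact: Pd.
have Sc (y : R -> R) : continuous y -> continuous (S y).
  by move=> yc; exact: lipschitz_cts (Slip _ yc).
have S0 (y : R -> R) : continuous y -> S y 0 = 0.
  by move=> yc; rewrite /S clamp_id ?P0// lexx ler0n.
have SB (y : R -> R) : continuous y -> forall t, `|S y t| <= 2 * B.
  move=> yc t.
  have -> : S y t = S y (clamp 0 2 t) by rewrite /S (clamp_id (c02 t)).
  have := Slip _ yc (clamp 0 2 t) 0; rewrite S0// !subr0 => /le_trans; apply.
  have /andP[c0 c2] := c02 t.
  by rewrite mulrC ler_wpM2r// ger0_norm.
have Sk (y z : R -> R) (E : R) : continuous y -> continuous z ->
    (forall t : R, `|y t - z t| <= E) ->
    forall t : R, `|S y t - S z t| <= E / 2.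
  move=> yc zc yz t; have E0 : 0 <= E := le_trans (normr_ge0 _) (yz 0).
  have /andP[t0 t2] := c02 t.
  have /= := @mvt_bound R (P y \- P z)
    (fun t => h t (y t) - h t (z t)) 0 (clamp 0 2 t) (E / 4) t0.
  rewrite !P0// subrr !subr0 => H; apply: (le_trans (H _ _ _)).
  - by apply: continuous_subspaceT => x; apply: continuousB; exact: Pc.
  - by move=> x _; apply: is_deriveB; exact: Pd.
  - move=> x _; apply: le_trans (hl _ _ _) _.
    by have := yz x; lra.
  - have : E / 4 * clamp 0 2 t <= E / 4 * 2 by rewrite ler_wpM2l// divr_ge0.
    lra.
pose u : nat -> R -> R := fix u k := if k is k'.+1 then S (u k') else fun=> 0.
have uc k : continuous (u k).
  by elim: k => [x|k IH]; [exact: cvg_cst|exact: Sc].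
have uu k (t : R) : `|u k.+1 t - u k t| <= 2 * B / 2 ^+ k.
  elim: k t => [t|k IH t].
    by rewrite expr0 divr1 /= subr0; apply: SB; exact: (uc 0%N).
  have := Sk _ _ _ (uc k.+1) (uc k) IH t.
  by rewrite exprSr invfM mulrA.
have /choice[n nP] : forall t : R, exists l : R,
    forall k, `|l - u k t| <= 2 * (2 * B) / 2 ^+ k.
  by move=> t; exact: geo_limit (uu^~ t).
have nlip (s t : R) : `|n s - n t| <= B * `|s - t|.
  apply: (@le_add_geo _ _ _ (4 * B)) => k.
  have := nP s k.+1; have := nP t k.+1; have := Slip _ (uc k) s t.
  rewrite exprS invfM /= !ler_norml => /andP[] ? ? /andP[] ? ? /andP[] ? ?.
  by apply/andP; split; lra.
have nc : continuous n := lipschitz_cts nlip.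
have nS (t : R) : n t = S n t.
  apply/eqP; rewrite -subr_eq0 -normr_le0; apply: (@le_add_geo0 _ _ (4 * B)) => k.
  have := Sk _ _ _ nc (uc k) (fun t => nP t k) t; have := nP t k.+1.
  rewrite exprS invfM /= !ler_norml => /andP[] ? ? /andP[] ? ?.
  by apply/andP; split; lra.
exists n; split=> //; first by rewrite nS S0.
  by move=> t; rewrite nS SB.
move=> t /andP[t0 t2].
apply: (@near_eq_is_derive _ _ _ (P n)); last exact: Pd.
near=> x; rewrite nS /S clamp_id//; apply/andP; split.
  by near: x; exact: lt_le_nbhsr.
by near: x; exact: lt_le_nbhsl.
Unshelve. all: by end_near. Qed.

(** A maximum argument replaces Gronwall: where [d = |n1 - n2|] is largest on [[0, 2]], say at [c],
    the mean value bound gives [d c <= (d c / 4 + e) * 2], hence [d c <= 4 * e]. *)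
Lemma picard_compare (R : realType) (h1 h2 : R -> R -> R) (n1 n2 : R -> R) (e : R)
    (hl : forall t y z, `|h1 t y - h1 t z| <= 4^-1 * `|y - z|)
    (n1c : continuous n1) (n2c : continuous n2) (n1_0 : n1 0 = 0) (n2_0 : n2 0 = 0)
    (n1d : forall t : R, 0 < t < 2 -> is_derive t 1 n1 (h1 t (n1 t)))
    (n2d : forall t : R, 0 < t < 2 -> is_derive t 1 n2 (h2 t (n2 t)))
    (he : forall t, 0 < t < 2 -> `|h1 t (n2 t) - h2 t (n2 t)| <= e) :
  forall t, 0 <= t <= 2 -> `|n1 t - n2 t| <= 4 * e.
Proof.
have e0 : 0 <= e.
  by apply: le_trans (he 1 _); rewrite ?normr_ge0// ltr01 ltr1n.
pose d t := `|n1 t - n2 t|.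
have dc : continuous d.
  by move=> t; apply: cvg_norm; apply: cvgB; [exact: n1c|exact: n2c].
have [//|c] := @EVT_max R d 0 2 _ (continuous_subspaceT dc).
rewrite in_itv/= => /andP[c0 c2] cmax.
have dc4 : d c <= (4^-1 * d c + e) * c.
  have /= := @mvt_bound R (n1 \- n2) (fun t => h1 t (n1 t) - h2 t (n2 t)) 0 c
    (4^-1 * d c + e) c0.
  rewrite n1_0 n2_0 subrr !subr0; apply.
  - apply: continuous_subspaceT => x; apply: continuousB; [exact: n1c|exact: n2c].
  - move=> x /andP[x0 xc].
    by apply: is_deriveB; [apply: n1d|apply: n2d]; rewrite x0 (lt_le_trans xc).
  - move=> x /andP[x0 xc]; rewrite -(subrKA (h1 x (n2 x))).
    apply: le_trans (ler_normD _ _) _; apply: lerD.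
      apply: le_trans (hl _ _ _) _; rewrite ler_wpM2l//; apply: cmax.
      by rewrite in_itv/= (ltW x0) ltW// (lt_le_trans xc).
    by apply: he; rewrite x0 (lt_le_trans xc).
have d0 : 0 <= d c := normr_ge0 _.
have : (4^-1 * d c + e) * c <= (4^-1 * d c + e) * 2.
  by rewrite ler_wpM2l// addr_ge0// mulr_ge0.
move=> H t t02; have := cmax t; rewrite in_itv/= => /(_ t02); rewrite -/(d t).
lra.
Qed.

(** * Lipschitz dependence on the radius and the parameter *)

Lemma ler_normMB (R : realType) (x y x' y' A B dx dy : R) :
  `|x| <= A -> `|y'| <= B -> `|x - x'| <= dx -> `|y - y'| <= dy ->
  `|x * y - x' * y'| <= A * dy + dx * B.
Proof.
move=> xA yB xd yd.
have -> : x * y - x' * y' = x * (y - y') + (x - x') * y' by ring.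
by apply: le_trans (ler_normD _ _) _; rewrite !normrM lerD// ler_pM.
Qed.

(** The constant is uniform in the index [t], later the angle, and it also bounds [f] itself, so
    that the class is closed under products. *)
Definition lip (R : realType) (T : Type) (r0 d0 : R) (f : T -> R -> R -> R) :=
  exists2 C : R, 0 <= C & forall t r l r' l', 0 <= r <= r0 -> `|l| <= d0 ->
    0 <= r' <= r0 -> `|l'| <= d0 ->
    `|f t r l| <= C /\ `|f t r l - f t r' l'| <= C * (`|r - r'| + `|l - l'|).

(* The factor [r + r'] records that the dependence on the parameter degenerates
   at the equilibrium; it is what makes the exponents below solvable for the
   parameter near [r = 0]. *)
Definition slip (R : realType) (T : Type) (r0 d0 : R) (f : T -> R -> R -> R) :=
  exists2 C : R, 0 <= C & forall t r l r' l', 0 <= r <= r0 -> `|l| <= d0 ->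
    0 <= r' <= r0 -> `|l'| <= d0 ->
    f t 0 l = 0 /\
    `|f t r l - f t r' l'| <= C * (`|r - r'| + (r + r') * `|l - l'|).

Lemma slip_ler (R : realType) (T : Type) (r0 d0 : R) (f : T -> R -> R -> R) :
  slip r0 d0 f -> exists2 C : R, 0 <= C & forall t r l,
    0 <= r <= r0 -> `|l| <= d0 -> `|f t r l| <= C * r.
Proof.
move=> [C C0 fC]; exists C => // t r l /andP[r_ge0 rr0] ld.
have [||||] := fC t r l 0 l => //; rewrite ?r_ge0 ?lexx ?(le_trans r_ge0)//.
by move=> ->; rewrite !subr0 subrr normr0 mulr0 addr0 (ger0_norm r_ge0).
Qed.

Lemma slipW (R : realType) (T : Type) (r0 r1 d0 d1 : R) (f : T -> R -> R -> R) :
  r1 <= r0 -> d1 <= d0 -> slip r0 d0 f -> slip r1 d1 f.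
Proof.
move=> r10 d10 [C C0 fC]; exists C => // t r l r' l' /andP[? ?] ? /andP[? ?] ?.
by apply: fC; first [lra | apply/andP; split; lra].
Qed.

Lemma lipW (R : realType) (T : Type) (r0 r1 d0 d1 : R) (f : T -> R -> R -> R) :
  r1 <= r0 -> d1 <= d0 -> lip r0 d0 f -> lip r1 d1 f.
Proof.
move=> r10 d10 [C C0 fC]; exists C => // t r l r' l' /andP[? ?] ? /andP[? ?] ?.
by apply: fC; first [lra | apply/andP; split; lra].
Qed.

Lemma slip_lip (R : realType) (T : Type) (r0 d0 : R) (f : T -> R -> R -> R) :
  slip r0 d0 f -> lip r0 d0 f.
Proof.
move=> sf; have [C1 C10 fC1] := slip_ler sf; case: sf => C C0 fC.
exists (C1 * `|r0| + C * (1 + 2 * `|r0|)) => [|t r l r' l' rr0 ld r'r0 l'd].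
  by rewrite addr_ge0// mulr_ge0// addr_ge0// mulr_ge0.
have ar0 := ler_norm r0.
have [rge rle] := andP rr0; have [r'ge r'le] := andP r'r0.
have a0 : 0 <= C1 * `|r0| by rewrite mulr_ge0.
have b0 : 0 <= C * (1 + 2 * `|r0|) by rewrite mulr_ge0// addr_ge0// mulr_ge0.
split.
  have : C1 * r <= C1 * `|r0| by rewrite ler_wpM2l// (le_trans rle).
  by have := fC1 t _ _ rr0 ld; lra.
have [_ H] := fC t _ _ _ _ rr0 ld r'r0 l'd; apply: (le_trans H).
apply: (@le_trans _ _ (C * (1 + 2 * `|r0|) * (`|r - r'| + `|l - l'|))); last first.
  by rewrite ler_wpM2r ?addr_ge0// lerDr.
rewrite -mulrA ler_wpM2l// mulrDr lerD//.
  by rewrite ler_peMl// lerDl mulr_ge0.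
by rewrite ler_wpM2r//; lra.
Qed.

Lemma lipD (R : realType) (T : Type) (r0 d0 : R) (f g : T -> R -> R -> R) :
  lip r0 d0 f -> lip r0 d0 g -> lip r0 d0 (fun t r l => f t r l + g t r l).
Proof.
move=> [C C0 fC] [D D0 gD]; exists (C + D) => [|t r l r' l' h1 h2 h3 h4].
  by rewrite addr_ge0.
have [f1 f2] := fC t _ _ _ _ h1 h2 h3 h4; have [g1 g2] := gD t _ _ _ _ h1 h2 h3 h4.
split; first by rewrite (le_trans (ler_normD _ _))// lerD.
by rewrite opprD addrACA (le_trans (ler_normD _ _))// mulrDl lerD.
Qed.

Lemma slipD (R : realType) (T : Type) (r0 d0 : R) (f g : T -> R -> R -> R) :
  slip r0 d0 f -> slip r0 d0 g -> slip r0 d0 (fun t r l => f t r l + g t r l).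
Proof.
move=> [C C0 fC] [D D0 gD]; exists (C + D) => [|t r l r' l' h1 h2 h3 h4].
  by rewrite addr_ge0.
have [f1 f2] := fC t _ _ _ _ h1 h2 h3 h4; have [g1 g2] := gD t _ _ _ _ h1 h2 h3 h4.
split; first by rewrite f1 g1 addr0.
by rewrite opprD addrACA (le_trans (ler_normD _ _))// mulrDl lerD.
Qed.

Lemma lipM (R : realType) (T : Type) (r0 d0 : R) (f g : T -> R -> R -> R) :
  lip r0 d0 f -> lip r0 d0 g -> lip r0 d0 (fun t r l => f t r l * g t r l).
Proof.
move=> [C C0 fC] [D D0 gD]; exists (2 * (C * D)) => [|t r l r' l' h1 h2 h3 h4].
  by rewrite !mulr_ge0.
have [f1 f2] := fC t _ _ _ _ h1 h2 h3 h4; have [g1 g2] := gD t _ _ _ _ h1 h2 h3 h4.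
have [g3 _] := gD t _ _ _ _ h3 h4 h1 h2.
have CD0 : 0 <= C * D by rewrite mulr_ge0.
split.
  have : `|f t r l| * `|g t r l| <= C * D by rewrite ler_pM.
  by rewrite normrM; lra.
by apply: le_trans (ler_normMB f1 g3 f2 g2) _; lra.
Qed.

(** The factor [g] is [O(r)] by [slip_ler]; this turns the plain Lipschitz dependence of [f] on the
    parameter into the degenerate one. *)
Lemma slipM (R : realType) (T : Type) (r0 d0 : R) (f g : T -> R -> R -> R) :
  lip r0 d0 f -> slip r0 d0 g -> slip r0 d0 (fun t r l => f t r l * g t r l).
Proof.
move=> [C C0 fC] sg; have [E E0 gE] := slip_ler sg; case: sg => D D0 gD.
exists (C * D + C * E * (`|r0| + 1)) => [|t r l r' l' h1 h2 h3 h4].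
  by rewrite addr_ge0 ?mulr_ge0.
have [f1 f2] := fC t _ _ _ _ h1 h2 h3 h4; have [g1 g2] := gD t _ _ _ _ h1 h2 h3 h4.
split; first by rewrite g1 mulr0.
apply: le_trans (ler_normMB f1 (gE t _ _ h3 h4) f2 g2) _.
rewrite [leRHS]mulrDl mulrA lerD2l mulrACA -[leRHS]mulrA ler_wpM2l ?mulr_ge0//.
have ar0 := ler_norm r0.
have [rge rle] := andP h1; have [r'ge r'le] := andP h3.
have : `|r - r'| * r' <= `|r - r'| * `|r0| by rewrite ler_wpM2l// (le_trans r'le).
have : 0 <= r * `|l - l'| by rewrite mulr_ge0.
have : 0 <= `|r0| * ((r + r') * `|l - l'|) by rewrite !mulr_ge0// addr_ge0.
have : 0 <= `|r - r'| by [].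
lra.
Qed.

Lemma lipV (R : realType) (T : Type) (r0 d0 m : R) (f : T -> R -> R -> R) :
  0 < m -> (forall t r l, 0 <= r <= r0 -> `|l| <= d0 -> m <= f t r l) ->
  lip r0 d0 f -> lip r0 d0 (fun t r l => (f t r l)^-1).
Proof.
move=> m0 fm [C C0 fC]; exists (m^-1 + C * m ^- 2) => [|t r l r' l' h1 h2 h3 h4].
  by rewrite addr_ge0 ?invr_ge0 ?(ltW m0)// mulr_ge0// invr_ge0 exprn_ge0// ltW.
have [f1 f2] := fC t _ _ _ _ h1 h2 h3 h4.
have m1 := fm t _ _ h1 h2; have m2 := fm t _ _ h3 h4.
have p1 := lt_le_trans m0 m1; have p2 := lt_le_trans m0 m2.
have v1 : (f t r l)^-1 <= m^-1 by rewrite lef_pV2.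
have v2 : (f t r' l')^-1 <= m^-1 by rewrite lef_pV2.
have a0 : 0 <= m^-1 by rewrite invr_ge0 ltW.
have b0 : 0 <= C * m ^- 2 by rewrite mulr_ge0// invr_ge0 exprn_ge0// ltW.
split; first by rewrite ger0_norm ?invr_ge0 ?(ltW p1)//; lra.
have -> : (f t r l)^-1 - (f t r' l')^-1 =
    (f t r l)^-1 * (f t r' l')^-1 * - (f t r l - f t r' l').
  by field; rewrite !gt_eqF.
rewrite normrM normrN ger0_norm ?mulr_ge0 ?invr_ge0 ?(ltW p1) ?(ltW p2)//.
apply: (@le_trans _ _ (m^-1 * m^-1 * (C * (`|r - r'| + `|l - l'|)))).
  rewrite ler_pM ?mulr_ge0 ?invr_ge0 ?(ltW p1) ?(ltW p2)//.
  by rewrite ler_pM ?invr_ge0 ?(ltW p1) ?(ltW p2).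
have : 0 <= m^-1 * (`|r - r'| + `|l - l'|) by rewrite mulr_ge0// addr_ge0.
by rewrite expr2 invfM; lra.
Qed.

Lemma lip_index (R : realType) (T : Type) (r0 d0 : R) (p : T -> R) :
  (forall t, `|p t| <= 1) -> lip r0 d0 (fun t _ _ => p t).
Proof.
move=> p1; exists 1 => // t r l r' l' _ _ _ _; split=> //.
by rewrite subrr normr0 mul1r addr_ge0 ?normr_ge0.
Qed.

(** A function of the parameter alone is seen as a family with trivial index and radius [0], so that
    closure lemmas such as [lipV] apply to it. *)
Definition lip1 (R : realType) (d0 : R) (f : R -> R) :=
  lip 0 d0 (fun (_ : unit) _ => f).

Lemma lip_param (R : realType) (T : Type) (r0 d0 : R) (f : R -> R) :
  lip1 d0 f -> lip r0 d0 (fun (_ : T) _ => f).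
Proof.
move=> [C C0 fC]; exists C => // t r l r' l' _ ld _ ld'.
have z : (0 : R) <= (0 : R) <= (0 : R) by rewrite lexx.
have [f1 f2] := fC tt 0 l 0 l' z ld z ld'; split => //; apply: (le_trans f2).
by rewrite subrr normr0 add0r ler_wpM2l// lerDr normr_ge0.
Qed.

(** Second-order flatness at the origin in Lipschitz form: on the square of half-side [e] the
    Lipschitz constant is [O(e)] in the plane variables and [O(e ^ 2)] in the parameter. *)
Definition quadratic (R : realType) (d0 C : R) (g : R -> R -> R -> R) :=
  (forall l, `|l| <= d0 -> g 0 0 l = 0) /\
  forall e u v l u' v' l' : R, e <= d0 -> `|u| <= e -> `|v| <= e -> `|l| <= d0 ->
    `|u'| <= e -> `|v'| <= e -> `|l'| <= d0 ->
    `|g u v l - g u' v' l'| <=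
      C * e * (`|u - u'| + `|v - v'| + e * `|l - l'|).

(** Division by the radius lowers each order by one. For [r' <= r] the estimate is taken at scale
    [K * r]; the change of denominator is harmless because the value at [r'] is [O(r' ^ 2)] while
    the inverses differ by [(r - r') / (r * r')] up to sign. *)
Lemma slip_polar (R : realType) (T : Type) (r0 d0 C K : R) (g : R -> R -> R -> R)
    (p : T -> R) (q : T -> R -> R) :
  0 <= C -> 1 <= K -> K * r0 <= d0 -> quadratic d0 C g ->
  (forall t, `|p t| <= 1) ->
  (forall t l l', `|l| <= d0 -> `|l'| <= d0 ->
     `|q t l| <= K /\ `|q t l - q t l'| <= K * `|l - l'|) ->
  slip r0 d0 (fun t r l => g (r * p t) (r * q t l) l / r).
Proof.
move=> C0 K1 Kr0 [g0 gC] p1 qK.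
have K0 : 0 <= K by rewrite (le_trans _ K1).
have key t r l r' l' : 0 <= r' <= r -> r <= r0 -> `|l| <= d0 -> `|l'| <= d0 ->
  `|g (r * p t) (r * q t l) l / r - g (r' * p t) (r' * q t l') l' / r'| <=
  4 * C * K ^+ 2 * (`|r - r'| + (r + r') * `|l - l'|).
  move=> /andP[r'0 r'r] rr0 ld l'd.
  have r_ge0 := le_trans r'0 r'r.
  (* At radius [0] the quotient is [0] by the convention on division, which is also its limit. *)
  move: (r_ge0); rewrite le_eqVlt => /predU1P[r00|r_gt0].
    have r'00 : r' = 0 by apply/le_anti; rewrite r'0 r00 r'r.
    rewrite r'00 -r00 invr0 !mulr0 subrr normr0.
    by rewrite mulr_ge0 ?addr_ge0 ?mulr_ge0 ?exprn_ge0.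
  have [q1 q2] := qK t l l' ld l'd; have [q1' _] := qK t l' l l'd ld.
  have Krd : K * r <= d0 by rewrite (le_trans _ Kr0)// ler_wpM2l.
  have pb s : 0 <= s -> `|s * p t| <= K * s.
    by move=> s0; rewrite normrM ger0_norm// mulrC ler_wpM2r// (le_trans (p1 t)).
  have qb s k : 0 <= s -> `|q t k| <= K -> `|s * q t k| <= K * s.
    by move=> s0 qk; rewrite normrM ger0_norm// mulrC ler_wpM2r.
  have Kr'r : K * r' <= K * r by rewrite ler_wpM2l.
  have e0 : 0 <= K * r by rewrite mulr_ge0.
  have e'0 : 0 <= K * r' by rewrite mulr_ge0.
  set X := g _ _ l; set Y := g _ _ l'.
  have rr'0 : 0 <= r - r' by rewrite subr_ge0.
  have XY : `|X - Y| <= C * (K * r) * ((r - r') + (K * (r - r') + r' * (K * `|l - l'|))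
      + K * r * `|l - l'|).
    apply: le_trans (gC (K * r) _ _ _ _ _ _ _ _ _ _ _ _ _) _ => //;
      rewrite ?pb ?qb// ?(le_trans (pb _ _)) ?(le_trans (qb _ _ _ _))//.
    apply: ler_wpM2l; first by rewrite !mulr_ge0.
    rewrite !lerD2r; apply: lerD.
      by rewrite -mulrBl normrM (ger0_norm rr'0) ler_piMr.
    have -> : r * q t l - r' * q t l' = (r - r') * q t l + r' * (q t l - q t l').
      by ring.
    apply: le_trans (ler_normD _ _) _; rewrite !normrM (ger0_norm rr'0).
    by rewrite (ger0_norm r'0) lerD// ?ler_wpM2l// mulrC ler_wpM2r.
  have Yb : `|Y| <= C * (K * r') * (r' + K * r').
    rewrite -[Y]subr0 -(g0 l' l'd).
    apply: le_trans (gC (K * r') _ _ _ _ _ _ _ _ _ _ _ _ _) _ => //;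
      rewrite ?pb ?qb ?normr0// ?(le_trans Kr'r)//.
    rewrite !subr0 subrr normr0 mulr0 addr0; apply: ler_wpM2l; first by rewrite !mulr_ge0.
    by apply: lerD; [rewrite normrM ger0_norm// ler_piMr|rewrite qb].
  have split_eq : X / r - Y / r' = (X - Y) / r + Y * (r^-1 - r'^-1) by ring.
  have P1 : `|(X - Y) / r| <=
      C * K * ((r - r') + (K * (r - r') + r' * (K * `|l - l'|)) + K * r * `|l - l'|).
    rewrite normrM normfV (gtr0_norm r_gt0) ler_pdivrMr//.
    by apply: le_trans XY _; rewrite le_eqVlt; apply/orP; left; apply/eqP; ring.
  have P2 : `|Y * (r^-1 - r'^-1)| <= C * K * (1 + K) * (r - r').
    move: (r'0); rewrite le_eqVlt => /predU1P[r'00|r'_gt0].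
      have -> : Y = 0.
        by apply/eqP; rewrite -normr_le0 (le_trans Yb)// -r'00 !mulr0 mul0r.
      by rewrite mul0r normr0 !mulr_ge0// addr_ge0.
    have -> : r^-1 - r'^-1 = - ((r - r') / (r * r')).
      by field; rewrite !gt_eqF.
    rewrite normrM normrN (ger0_norm (_ : 0 <= _ / _)); last first.
      by rewrite divr_ge0 ?mulr_ge0.
    rewrite mulrA ler_pdivrMr ?mulr_gt0//.
    apply: (@le_trans _ _ (C * (K * r') * (r' + K * r') * (r - r'))).
      by rewrite ler_wpM2r.
    have -> : C * (K * r') * (r' + K * r') * (r - r') =
      C * K * (1 + K) * (r - r') * r' * r' by ring.
    rewrite [leRHS]mulrA ler_wpM2r// ler_wpM2l// !mulr_ge0// addr_ge0//.
  rewrite split_eq; apply: le_trans (ler_normD _ _) _.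
  rewrite (ger0_norm rr'0).
  have CK0 : 0 <= C * K by rewrite mulr_ge0.
  have H1 : C * K * (r - r') <= C * K * K * (r - r').
    by rewrite ler_wpM2r// ler_peMr.
  have H2 : 0 <= C * K * K * r * `|l - l'| by rewrite !mulr_ge0.
  have H3 : 0 <= C * K * K * r' * `|l - l'| by rewrite !mulr_ge0.
  by move: P1 P2 H1 H2 H3; rewrite expr2; lra.
exists (4 * C * K ^+ 2); first by rewrite !mulr_ge0 ?exprn_ge0.
move=> t r l r' l' /andP[r_ge0 rr0] ld /andP[r'0 r'r0] l'd; split.
  by rewrite invr0 mulr0.
have [rr'|/ltW rr'] := leP r' r; first by apply: key => //; rewrite r'0.
rewrite distrC (distrC r) (distrC l) (addrC r); apply: key => //.
by rewrite r_ge0.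
Qed.

(** * Estimates from the power series *)

Lemma ler_distX (R : realType) (x y e : R) (n : nat) :
  `|x| <= e -> `|y| <= e -> `|x ^+ n - y ^+ n| <= n%:R * e ^+ n.-1 * `|x - y|.
Proof.
move=> xe ye; have e0 : 0 <= e := le_trans (normr_ge0 _) xe.
elim: n => [|n IH]; first by rewrite !expr0 subrr normr0 !mul0r.
rewrite !exprS /=; apply: le_trans (ler_normMB (B := e ^+ n) xe _ (lexx _) IH) _.
  by rewrite normrX lerXn2r// nnegrE.
case: n {IH} => [|n]; first by rewrite !mul0r mulr0 expr0 add0r mulrC !mul1r.
rewrite -[n.+2%:R]natr1 /= exprS; move: (n.+1%:R) (e ^+ n) => ? ?.
by rewrite le_eqVlt; apply/orP; left; apply/eqP; ring.
Qed.

(** Degree at least two in [(u, v)] leaves a factor [e] after a difference in a plane variable and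
    [e ^ 2] after one in [l]. The exponents brought down by these differences are at most
    [2 ^ (i + j + k)], which turns powers of [d] into powers of [2 * d]; [d ^- 2] and [d ^- 3] repay
    the powers of [d] added on the way. *)
Lemma ler_dist_monomial (R : realType) (d e u v l u' v' l' : R) (i j k : nat) :
  0 < d -> e <= d -> `|u| <= e -> `|v| <= e -> `|l| <= d ->
  `|u'| <= e -> `|v'| <= e -> `|l'| <= d -> (2 <= i + j)%N ->
  `|u ^+ i * v ^+ j * l ^+ k - u' ^+ i * v' ^+ j * l' ^+ k| <=
  (2 * d) ^+ (i + j + k) *
    ((d ^- 2 + d ^- 3) * e * (`|u - u'| + `|v - v'| + e * `|l - l'|)).
Proof.
move=> d0 ed ue ve ld u'e v'e l'd ij2.
have e0 : 0 <= e := le_trans (normr_ge0 _) ue.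
have pw x n : `|x| <= e -> `|x ^+ n| <= e ^+ n.
  by move=> xe; rewrite normrX lerXn2r// nnegrE.
have uv : `|u ^+ i * v ^+ j - u' ^+ i * v' ^+ j| <=
    (i + j)%:R * e ^+ (i + j).-1 * (`|u - u'| + `|v - v'|).
  apply: le_trans (ler_normMB (pw _ _ ue) (pw _ _ v'e)
    (ler_distX i ue u'e) (ler_distX j ve v'e)) _.
  rewrite natrD.
  have eu : (i%:R : R) * e ^+ i.-1 * e ^+ j = i%:R * e ^+ (i + j).-1.
    by case: i {ij2} => [|i]; rewrite ?mul0r// -mulrA -exprD.
  have ev : e ^+ i * ((j%:R : R) * e ^+ j.-1) = j%:R * e ^+ (i + j).-1.
    by case: j {ij2 eu} => [|j]; rewrite ?mul0r ?mulr0// mulrCA -exprD addnS.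
  rewrite mulrA ev [X in _ + X]mulrAC eu.
  have E0 : 0 <= e ^+ (i + j).-1 by rewrite exprn_ge0.
  move: (e ^+ _) E0 (i%:R : R) (j%:R : R) (ler0n R i) (ler0n R j).
  move=> E E0 I J I0 J0.
  have : 0 <= I * E * `|v - v'| by rewrite !mulr_ge0.
  have : 0 <= J * E * `|u - u'| by rewrite !mulr_ge0.
  lra.
have uve : `|u ^+ i * v ^+ j| <= e ^+ (i + j).
  by rewrite normrM exprD ler_pM// pw.
have lk : `|l' ^+ k| <= d ^+ k by rewrite normrX lerXn2r// nnegrE ltW.
apply: le_trans (ler_normMB uve lk uv (ler_distX k ld l'd)) _.
move: ij2; move: (i + j)%N => [|[|p]]// _.
have n2 n m : (n <= m)%N -> (n%:R : R) <= 2 ^+ m.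
  move=> nm; apply: (@le_trans _ _ m%:R); first by rewrite ler_nat.
  by rewrite -natrX ler_nat; exact/ltnW/ltn_expl.
set D := `|u - u'| + `|v - v'|; set L := `|l - l'|.
have D0 : 0 <= D by rewrite addr_ge0.
have L0 : 0 <= L := normr_ge0 _.
have ep : e ^+ p <= d ^+ p by rewrite lerXn2r// nnegrE ltW.
have dn0 : d != 0 by rewrite gt_eqF.
have H1 : p.+2%:R * e ^+ p.+1 * D * d ^+ k <=
    (2 * d) ^+ (p.+2 + k) * (d ^- 2 * e * D).
  have -> : (2 * d) ^+ (p.+2 + k) * (d ^- 2 * e * D) =
      2 ^+ (p.+2 + k) * (d ^+ p) * d ^+ k * (e * D).
    rewrite exprMn (exprD d) -[p.+2]addn2 (exprD d p).
    by move: (2 ^+ _) (d ^+ p) (d ^+ k) => ? ? ?; field.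
  have -> : p.+2%:R * e ^+ p.+1 * D * d ^+ k =
      p.+2%:R * e ^+ p * d ^+ k * (e * D).
    rewrite exprS; move: (_%:R) (e ^+ p) (d ^+ k) => ? ? ?; ring.
  rewrite ler_wpM2r ?mulr_ge0// ler_wpM2r ?exprn_ge0 ?(ltW d0)//.
  by rewrite ler_pM ?exprn_ge0// n2// leq_addr.
have H2 : e ^+ p.+2 * (k%:R * d ^+ k.-1 * L) <=
    (2 * d) ^+ (p.+2 + k) * (d ^- 3 * e * (e * L)).
  case: k {lk H1} => [|k].
    rewrite !mul0r mulr0 mulr_ge0 ?exprn_ge0 ?(mulr_ge0 _ (ltW d0))//.
    by rewrite !mulr_ge0// invr_ge0 exprn_ge0// ltW.
  have -> : (2 * d) ^+ (p.+2 + k.+1) * (d ^- 3 * e * (e * L)) =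
      2 ^+ (p.+2 + k.+1) * (d ^+ p) * d ^+ k * (e * (e * L)).
    rewrite exprMn (exprD d) -[p.+2]addn2 (exprD d p) (exprS d k).
    by move: (2 ^+ _) (d ^+ p) (d ^+ k) => ? ? ?; field.
  have -> : e ^+ p.+2 * (k.+1%:R * d ^+ k.+1.-1 * L) =
      k.+1%:R * e ^+ p * d ^+ k * (e * (e * L)).
    rewrite !exprS /=; move: (k.+1%:R) (e ^+ p) (d ^+ k) => ? ? ?; ring.
  rewrite ler_wpM2r ?mulr_ge0// ler_wpM2r ?exprn_ge0 ?(ltW d0)//.
  by rewrite ler_pM ?exprn_ge0// n2// leq_addl.
have P0 : 0 <= (2 * d) ^+ (p.+2 + k) by rewrite exprn_ge0// mulr_ge0// ltW.
have Q2 : 0 <= d ^- 2 by rewrite invr_ge0 exprn_ge0// ltW.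
have Q3 : 0 <= d ^- 3 by rewrite invr_ge0 exprn_ge0// ltW.
have H3 : 0 <= (2 * d) ^+ (p.+2 + k) * (d ^- 3 * e * D).
  exact: mulr_ge0 P0 (mulr_ge0 (mulr_ge0 Q3 e0) D0).
have H4 : 0 <= (2 * d) ^+ (p.+2 + k) * (d ^- 2 * e * (e * L)).
  exact: mulr_ge0 P0 (mulr_ge0 (mulr_ge0 Q2 e0) (mulr_ge0 e0 L0)).
have -> : (2 * d) ^+ (p.+2 + k) * ((d ^- 2 + d ^- 3) * e * (D + e * L)) =
  (2 * d) ^+ (p.+2 + k) * (d ^- 2 * e * D) +
  (2 * d) ^+ (p.+2 + k) * (d ^- 3 * e * (e * L)) +
  ((2 * d) ^+ (p.+2 + k) * (d ^- 3 * e * D) +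
   (2 * d) ^+ (p.+2 + k) * (d ^- 2 * e * (e * L))).
  by move: (_ ^+ _) (d ^- 2) (d ^- 3) => ? ? ?; ring.
rewrite addrC; apply: le_trans (lerD H1 H2) _.
by rewrite lerDl addr_ge0.
Qed.

(** * Splitting a triple series by its degree in the plane variables *)

Definition sum3 (R : realType) (N : nat) (F : nat -> nat -> nat -> R) : R :=
  \sum_(i < N) \sum_(j < N) \sum_(k < N) F i j k.

Lemma sum3D (R : realType) (N : nat) (F G : nat -> nat -> nat -> R) :
  sum3 N F + sum3 N G = sum3 N (fun i j k => F i j k + G i j k).
Proof.
rewrite /sum3 -big_split; apply: eq_bigr => i _.
by rewrite -big_split; apply: eq_bigr => j _; rewrite -big_split.
Qed.

Lemma sum3M (R : realType) (N : nat) (F : nat -> nat -> nat -> R) (a : R) :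
  a * sum3 N F = sum3 N (fun i j k => a * F i j k).
Proof.
rewrite /sum3 mulr_sumr; apply: eq_bigr => i _.
by rewrite mulr_sumr; apply: eq_bigr => j _; rewrite mulr_sumr.
Qed.

Lemma eq_sum3 (R : realType) (N : nat) (F G : nat -> nat -> nat -> R) :
  (forall i j k, F i j k = G i j k) -> sum3 N F = sum3 N G.
Proof. by move=> FG; do 3![apply: eq_bigr => ? _]. Qed.

Lemma sum3B (R : realType) (N : nat) (F G : nat -> nat -> nat -> R) :
  sum3 N F - sum3 N G = sum3 N (fun i j k => F i j k - G i j k).
Proof.
by rewrite -mulN1r sum3M sum3D; apply: eq_sum3 => i j k; rewrite mulN1r.
Qed.

Lemma ler_sum3 (R : realType) (N : nat) (F G : nat -> nat -> nat -> R) :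
  (forall i j k, F i j k <= G i j k) -> sum3 N F <= sum3 N G.
Proof. by move=> FG; do 3![apply: ler_sum => ? _]. Qed.

Lemma ler_norm_sum3 (R : realType) (N : nat) (F : nat -> nat -> nat -> R) :
  `|sum3 N F| <= sum3 N (fun i j k => `|F i j k|).
Proof.
by do 3![apply: le_trans (ler_norm_sum _ _ _) _; apply: ler_sum => ? _].
Qed.

Section power_series.
Variables (R : realType) (c : nat -> nat -> nat -> R) (s B d1 : R).
Variable G : R -> R -> R -> R.
Hypotheses (s0 : 0 < s) (d10 : 0 < d1).
Hypothesis cB : forall N, sum3 N (fun i j k => `|c i j k| * s ^+ (i + j + k)) <= B.
Hypothesis cG : forall u v l, `|u| <= s -> `|v| <= s -> `|l| <= s ->
  (fun N => sum3 N (fun i j k => u ^+ i * v ^+ j * l ^+ k * c i j k)) @ \oo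
    --> G u v l.
Hypothesis G0 : forall l, `|l| <= d1 -> G 0 0 l = 0.
Hypothesis Go : forall u v l e, `|u| <= s -> `|v| <= s -> `|l| <= d1 -> 0 < e ->
  exists2 t0, 0 < t0 & forall t, 0 < t < t0 -> `|G (t * u) (t * v) l| <= e * t.

(** At most half of [s], because [ler_dist_monomial] costs a power of [2 * d], which the summability
    in [cB] at radius [s] must absorb. *)
Let d : R := Num.min (s / 2) d1.
Let C : R := B * (d ^- 2 + d ^- 3).

(** [high] keeps the terms of degree at least two in [(u, v)] and [low] the others. The latter
    vanish in the limit as a whole; no individual coefficient is shown to be zero. *)
Let high N u v l := sum3 N (fun i j k =>
  (u ^+ i * v ^+ j * l ^+ k) *+ (2 <= i + j)%N * c i j k).

Let low N u v l := sum3 N (fun i j k =>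
  (u ^+ i * v ^+ j * l ^+ k) *+ (i + j < 2)%N * c i j k).

Let d_gt0 : 0 < d. Proof. by rewrite lt_min divr_gt0. Qed.

Let d_le : d <= d1. Proof. by rewrite ge_min lexx orbT. Qed.

Let d2s : 2 * d <= s. Proof. by rewrite -ler_pdivlMl// mulrC ge_min lexx. Qed.

Let ds : d <= s. Proof. by move: d_gt0 d2s; lra. Qed.

Let B0 : 0 <= B.
Proof. by apply: le_trans (cB 0); rewrite /sum3 big_ord0. Qed.

Let C0 : 0 <= C.
Proof. by rewrite mulr_ge0// addr_ge0// invr_ge0 exprn_ge0// ltW. Qed.

Let highlow N u v l : high N u v l + low N u v l =
  sum3 N (fun i j k => u ^+ i * v ^+ j * l ^+ k * c i j k).
Proof.
rewrite sum3D; apply: eq_sum3 => i j k; rewrite -mulrDl -mulrnDr.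
by case: (ltnP (i + j) 2) => _ /=; rewrite ?addn0 ?add0n ?mulr1n.
Qed.

Let high_dist N (e u v l u' v' l' : R) : e <= d -> `|u| <= e -> `|v| <= e ->
  `|l| <= d -> `|u'| <= e -> `|v'| <= e -> `|l'| <= d ->
  `|high N u v l - high N u' v' l'| <=
    C * e * (`|u - u'| + `|v - v'| + e * `|l - l'|).
Proof.
move=> ed ue ve ld u'e v'e l'd.
have e0 : 0 <= e := le_trans (normr_ge0 _) ue.
set X := `|u - u'| + _ + _.
have X0 : 0 <= X by rewrite !addr_ge0 ?mulr_ge0 ?normr_ge0.
have D0 : 0 <= d ^- 2 + d ^- 3 by rewrite addr_ge0// invr_ge0 exprn_ge0// ltW.
apply: (@le_trans _ _ ((d ^- 2 + d ^- 3) * e * X *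
    sum3 N (fun i j k => `|c i j k| * s ^+ (i + j + k)))); last first.
  rewrite mulrC /C -!mulrA ler_wpM2r ?cB// !mulr_ge0//.
rewrite /high sum3B sum3M; apply: le_trans (ler_norm_sum3 _ _) _.
apply: ler_sum3 => i j k; rewrite -mulrBl normrM mulrA.
rewrite [leRHS]mulrAC [leRHS]mulrC [leRHS]mulrC ler_wpM2r//.
have Y0 : 0 <= (d ^- 2 + d ^- 3) * e * X by rewrite !mulr_ge0.
case: (leqP 2 (i + j)) => [ij|_]; last first.
  by rewrite !mulr0n subrr normr0 mulr_ge0// exprn_ge0// ltW.
rewrite !mulr1n.
apply: le_trans (ler_dist_monomial k d_gt0 ed ue ve ld u'e v'e l'd ij) _.
rewrite mulrC ler_wpM2l// lerXn2r// nnegrE ?(ltW s0)//.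
by rewrite mulr_ge0// ltW.
Qed.

Let high0 N l : high N 0 0 l = 0.
Proof.
rewrite /high -[RHS](mul0r (sum3 N (fun=> fun=> fun=> 0))) sum3M.
apply: eq_sum3 => i j k; rewrite mul0r.
by case: i j => [|i] [|j]; rewrite ?mulr0n ?mul0r// !exprS !(mul0r, mulr0) mul0rn mul0r.
Qed.

Let lowM N t u v l :
  low N (t * u) (t * v) l - low N 0 0 l = t * (low N u v l - low N 0 0 l).
Proof.
rewrite /low !sum3B sum3M; apply: eq_sum3 => i j k.
rewrite -!mulrBl mulrA; congr (_ * _).
by case: i j => [|[|i]] [|[|j]]; rewrite ?mulr0n ?mulr1n ?expr0 ?expr1; ring.
Qed.

Let dist_G (u v l e : R) : `|u| <= s -> `|v| <= s -> `|l| <= d -> 0 < e ->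
  \forall N \near \oo, `|high N u v l + low N u v l - G u v l| <= e.
Proof.
move=> us vs ld e0; have ls := le_trans ld ds.
have /cvgrPdist_le /(_ e e0) := cG us vs ls; apply: filterS => N.
by rewrite distrC highlow.
Qed.

(** [low] is affine in [(u, v)], so shrinking the point by [t] scales its variation exactly by [t],
    whereas [G] is [o(t)] there and [high] is [O(t ^ 2)] uniformly in [N]. Comparing them at one
    small fixed [t] while [N] grows leaves nothing of order [t] for [low]. *)
Let low_cvg0 (u v l e : R) : `|u| <= d -> `|v| <= d -> `|l| <= d -> 0 < e ->
  \forall N \near \oo, `|low N u v l| <= e.
Proof.
move=> ud vd ld e0.
(* Five shares: at the shrunk point the truncation error, [G] and [high], and twice the constant
   term [low N 0 0 l]. *)
pose a := e / 5; have a0 : 0 < a by rewrite divr_gt0.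
have us := le_trans ud ds; have vs := le_trans vd ds; have ld1 := le_trans ld d_le.
have [t0 t00 tG] := Go us vs ld1 a0.
pose K := C * d * (d + d); have K0 : 0 <= K.
  exact: mulr_ge0 (mulr_ge0 C0 (ltW d_gt0)) (addr_ge0 (ltW d_gt0) (ltW d_gt0)).
pose t := Num.min (t0 / 2) (Num.min 1 (a / (K + 1))).
have K1 : 0 < K + 1 by rewrite ltr_wpDl.
have t_gt0 : 0 < t by rewrite /t !lt_min ltr01 (divr_gt0 t00) ?(divr_gt0 a0 K1).
have tt0 : t < t0.
  by apply: (@le_lt_trans _ _ (t0 / 2)); [rewrite ge_min lexx|lra].
have t1 : t <= 1 by rewrite /t !ge_min lexx orbT.
have tK : K * t <= a.
  have : t <= a / (K + 1) by rewrite /t !ge_min lexx !orbT.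
  by rewrite ler_pdivlMr//; lra.
have Gt : `|G (t * u) (t * v) l| <= a * t by apply: tG; rewrite t_gt0.
have at0 : 0 < a * t by rewrite mulr_gt0.
have tn x : `|x| <= d -> `|t * x| <= t * d.
  by move=> xd; rewrite normrM gtr0_norm// ler_wpM2l// ltW.
have td : t * d <= d by rewrite ler_piMl// ltW.
have tus x : `|x| <= d -> `|t * x| <= s.
  by move=> xd; rewrite (le_trans (tn _ xd))// (le_trans td).
have s00 : `|0 : R| <= s by rewrite normr0 ltW.
near=> N.
have N1 : `|high N (t * u) (t * v) l + low N (t * u) (t * v) l
    - G (t * u) (t * v) l| <= a * t.
  by near: N; apply: dist_G => //; exact: tus.
have N2 : `|high N 0 0 l + low N 0 0 l - G 0 0 l| <= a * t.
  by near: N; apply: dist_G.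
rewrite G0// high0 add0r subr0 in N2.
have H : `|high N (t * u) (t * v) l| <= K * t * t.
  rewrite -[high _ _ _ _]subr0 -(high0 N l).
  apply: le_trans (high_dist (e := t * d) _ _ _ _ _ _ _ _) _ => //;
    rewrite ?normr0 ?tn ?mulr_ge0 ?(ltW t_gt0) ?(ltW d_gt0)//.
  rewrite !subr0 subrr normr0 mulr0 addr0 /K.
  apply: (@le_trans _ _ (C * (t * d) * (t * d + t * d))).
    rewrite ler_wpM2l ?lerD ?tn//.
    exact: mulr_ge0 C0 (mulr_ge0 (ltW t_gt0) (ltW d_gt0)).
  by rewrite le_eqVlt; apply/orP; left; apply/eqP; ring.
have H' : K * t * t <= a * t by rewrite ler_wpM2r// ltW.
have := lowM N t u v l.
set x := low N (t * u) _ _ in N1 *; set y := low N 0 0 l in N2 *.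
set z := low N u v l => E.
have : t * `|z - y| <= 4 * a * t.
  rewrite -{1}(gtr0_norm t_gt0) -normrM -E.
  move: N1 N2 H Gt; rewrite !ler_norml.
  move=> /andP[? ?] /andP[? ?] /andP[? ?] /andP[? ?].
  by apply/andP; split; lra.
rewrite [4 * a * t]mulrC ler_pM2l// => zy.
have ya : `|y| <= a by rewrite (le_trans N2)// ler_piMr// ltW.
move: zy ya; rewrite /a !ler_norml => /andP[? ?] /andP[? ?].
by apply/andP; split; lra.
Unshelve. all: by end_near. Qed.

Lemma power_series_quadratic : exists d C : R, [/\ 0 < d, 0 <= C & quadratic d C G].
Proof.
exists d, C; split=> //; split=> [l ld|]; first by rewrite G0// (le_trans ld).
move=> e u v l u' v' l' ed ue ve ld u'e v'e l'd.
apply/ler_addgt0Pr => a a0.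
pose b := a / 4; have b0 : 0 < b by rewrite divr_gt0.
have es := le_trans ed ds.
near \oo => N.
have H1 : `|high N u v l + low N u v l - G u v l| <= b.
  by near: N; apply: dist_G => //; [apply: le_trans ue _|apply: le_trans ve _].
have H2 : `|high N u' v' l' + low N u' v' l' - G u' v' l'| <= b.
  by near: N; apply: dist_G => //; [apply: le_trans u'e _|apply: le_trans v'e _].
have H3 : `|low N u v l| <= b.
  by near: N; apply: low_cvg0 => //; [apply: le_trans ue _|apply: le_trans ve _].
have H4 : `|low N u' v' l'| <= b.
  by near: N; apply: low_cvg0 => //; [apply: le_trans u'e _|apply: le_trans v'e _].
have := high_dist N ed ue ve ld u'e v'e l'd.
set X := C * e * _.
move: H1 H2 H3 H4; rewrite /b !ler_norml.
move=> /andP[? ?] /andP[? ?] /andP[? ?] /andP[? ?] /andP[? ?].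
by apply/andP; split; lra.
Unshelve. all: by end_near. Qed.

End power_series.

(** * The perturbation in coordinates *)

Lemma col2E0 (R : realType) (u v : R) : col2 u v 0 0 = u.
Proof. by rewrite mxE. Qed.

Lemma col2E1 (R : realType) (u v : R) : col2 u v 1 0 = v.
Proof. by rewrite mxE. Qed.

Lemma col2_eta (R : realType) (x : 'cV[R]_2) : x = col2 (x 0 0) (x 1 0).
Proof.
apply/matrixP => i j; rewrite mxE (ord1 j).
by case: ifPn => [/eqP ->//|i0]; congr (x _ _); case: i i0 => -[|[|]]// ? _;
  apply: val_inj.
Qed.

Lemma ler_norm_entry (R : realType) (x : 'cV[R]_2) (i : 'I_2) : `|x i 0| <= `|x|.
Proof. by rewrite [leRHS]/Num.Def.normr/= mx_normrE (le_bigmax _ _ (i, 0)). Qed.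

Lemma ler_norm_col2 (R : realType) (u v e : R) :
  `|u| <= e -> `|v| <= e -> `|col2 u v| <= e.
Proof.
move=> ue ve; rewrite [leLHS]/Num.Def.normr/= mx_normrE.
apply: bigmax_le => [|[i j] _ /=]; first exact: le_trans (normr_ge0 _) ue.
by rewrite mxE; case: ifP.
Qed.

Lemma cvg_entry (R : realType) {F : set_system nat} {FF : Filter F} (i : 'I_2)
    (f : nat -> 'cV[R]_2) (x : 'cV[R]_2) :
  f @ F --> x -> (fun n => f n i 0) @ F --> x i 0.
Proof.
move=> fx; apply/cvgrPdist_le => e e0.
move/cvgrPdist_le : fx => /(_ e e0); apply: filterS => n; apply: le_trans.
by have := ler_norm_entry (x - f n) i; rewrite !mxE.
Qed.

Lemma analytic_quadratic (R : realType) (g : 'cV[R]_2 -> R -> 'cV[R]_2) (d1 : R)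
    (a : 'I_2) :
  analytic_at g 0 0 -> 0 < d1 ->
  (forall l, `|l| <= d1 ->
     (fun x : 'cV[R]_2 => g x l) =o_ (nbhs (0 : 'cV[R]_2)) id) ->
  exists d C : R, [/\ 0 < d, 0 <= C &
    quadratic d C (fun u v l => g (col2 u v) l a 0)].
Proof.
move=> [c [r [r0 cr]]] d10 go.
pose s := r / 2; have s0 : 0 < s by rewrite divr_gt0.
have sr : s < r by rewrite /s; lra.
have col2r u v : `|u| <= s -> `|v| <= s -> `|col2 u v| < r.
  by move=> us vs; apply: le_lt_trans sr; exact: ler_norm_col2.
have ss : `|s| <= s by rewrite gtr0_norm.
(* One point with all coordinates equal to [s] suffices: absolute convergence there bounds every
   weighted partial sum of the coefficients. *)
have [/cvg_seq_bounded [M [_ MB]] _] := cr _ _ (col2r s s ss ss) (le_lt_trans ss sr).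
pose B := M + 1.
have cB N : sum3 N (fun i j k => `|c i j k a 0| * s ^+ (i + j + k)) <= B.
  have MltB : M < B by rewrite ltrDl.
  have /= := MB B MltB N I.
  move=> /(le_trans (ler_norm _)); apply: le_trans.
  do 3![apply: ler_sum => ? _].
  rewrite normrZ col2E0 col2E1 -!exprD ger0_norm ?exprn_ge0 ?(ltW s0)//.
  by rewrite mulrC ler_wpM2l ?exprn_ge0 ?(ltW s0)// ler_norm_entry.
have o_near l : `|l| <= d1 -> forall e, 0 < e ->
    \forall x \near (0 : 'cV[R]_2), `|g x l| <= e * `|x|.
  by move=> /go/eqoP H e e0; have := H e e0.
have g0 l : `|l| <= d1 -> g 0 l = 0.
  move=> /o_near /(_ 1 ltr01) /nbhs_singleton.
  by rewrite normr0 mulr0 normr_le0 => /eqP.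
have col0 : col2 0 0 = 0 :> 'cV[R]_2.
  by apply/matrixP => i j; rewrite !mxE; case: ifP.
apply: (@power_series_quadratic _ (fun i j k => c i j k a 0) s B d1) => //.
- move=> u v l us vs ls.
  have [_] := cr _ _ (col2r u v us vs) (le_lt_trans ls sr).
  rewrite !add0r => /(@cvg_entry _ _ _ a); apply: cvg_trans.
  apply: near_eq_cvg; near=> N.
  rewrite /sum3 summxE; apply: eq_bigr => i _.
  rewrite summxE; apply: eq_bigr => j _; rewrite summxE; apply: eq_bigr => k _.
  by rewrite mxE col2E0 col2E1.
- by move=> l ld; rewrite col0 g0// mxE.
- move=> u v l e us vs ld e0.
  have es : 0 < e / s by rewrite divr_gt0.
  have /nbhs_normP[t1 /= t10 H] := o_near _ ld _ es.
  exists (t1 / s); first by rewrite divr_gt0.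
  move=> t /andP[t0 tt]; apply: le_trans (ler_norm_entry _ _) _.
  have ts : `|col2 (t * u) (t * v)| <= t * s.
    by apply: ler_norm_col2; rewrite normrM (gtr0_norm t0) ler_wpM2l// ltW.
  apply: le_trans (H _ _) _.
    by rewrite /= sub0r normrN (le_lt_trans ts)// -ltr_pdivlMr.
  apply: le_trans (ler_wpM2l (ltW es) ts) _.
  by rewrite le_eqVlt; apply/orP; left; apply/eqP; field; rewrite gt_eqF.
Unshelve. all: by end_near. Qed.

(** * Crossing one quadrant *)

(** The lower bound on the slope makes [f] injective and unbounded on both sides, hence onto by the
    intermediate value theorem. It serves to invert time as a function of the angle. *)
Lemma inverse_of_expanding (R : realType) (f df : R -> R) (m : R) :
  0 < m -> (forall x : R, is_derive x 1 f (df x)) -> (forall x, m <= df x) ->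
  exists g : R -> R, [/\ cancel f g, cancel g f, {homo g : x y / x < y} &
    forall t : R, is_derive t 1 g (df (g t))^-1].
Proof.
move=> m0 fd dfm.
have fc : continuous f by move=> x; exact: is_derive_continuous (fd x).
have f_grow (x y : R) : x < y -> m * (y - x) <= f y - f x.
  move=> xy; have [c _ ->] := MVT xy (fun z _ => fd z) (continuous_subspaceT fc).
  by rewrite ler_wpM2r// subr_ge0 ltW.
have f_inc (x y : R) : x < y -> f x < f y.
  move=> xy; rewrite -subr_gt0; apply: lt_le_trans (f_grow _ _ xy).
  by rewrite mulr_gt0// subr_gt0.
have f_inj (x y : R) : f x = f y -> x = y.
  by case: (ltgtP x y) => // /f_inc h e; move: h; rewrite e ltxx.
have /choice[g gK] : forall t : R, exists x : R, f x = t.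
  move=> t; pose M := `|t - f 0| / m + 1.
  have M0 : 0 < M by rewrite ltr_wpDl// divr_ge0// ltW.
  have mM : `|t - f 0| <= m * M.
    by rewrite /M mulrDr mulr1 mulrC divfK ?gt_eqF// lerDl ltW.
  have NM : - M < M by lra.
  have M1 := f_grow _ _ M0; have N0 : - M < 0 by lra.
  have M2 := f_grow _ _ N0.
  move: mM; rewrite ler_norml => /andP[? ?].
  have [|x _ xt] := @IVT R f (- M) M t (ltW NM) (continuous_subspaceT fc).
    have /ltW fNM := f_inc _ _ NM.
    rewrite (min_idPl fNM) (max_idPr fNM).
    by apply/andP; split; lra.
  by exists x.
have fK : cancel f g by move=> x; apply: f_inj; rewrite gK.
exists g; split => //.
  move=> x y xy; rewrite ltNge le_eqVlt; apply/negP => /orP[/eqP e|/f_inc].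
    by move: xy; rewrite -(gK x) -(gK y) e ltxx.
  by rewrite !gK => /(lt_trans xy); rewrite ltxx.
move=> t; rewrite -{1}(gK t); apply: (@is_derive_inverse _ f) => //.
- by near=> x.
- by near=> x; exact: fc.
- by rewrite gt_eqF// (lt_le_trans m0).
Unshelve. all: by end_near. Qed.

Lemma quadratic_continuous (R : realType) (d0 C : R) (g : R -> R -> R -> R)
    (u v : R -> R) (l : R) :
  0 <= C -> 0 <= d0 -> quadratic d0 C g -> `|l| <= d0 ->
  (forall x, `|u x| <= d0) -> (forall x, `|v x| <= d0) ->
  continuous u -> continuous v -> continuous (fun x => g (u x) (v x) l).
Proof.
move=> C0 d00 [_ gC] ld ud vd uc vc x; apply/cvgrPdist_le => e e0.
have K0 : 0 < C * d0 + 1 by rewrite ltr_wpDl// mulr_ge0.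
have h0 : 0 < e / (C * d0 + 1) / 2 by rewrite !divr_gt0.
near=> y.
apply: le_trans (gC d0 _ _ _ _ _ _ _ _ _ _ _ _ _) _ => //.
rewrite subrr normr0 mulr0 addr0.
have H1 : `|u x - u y| <= e / (C * d0 + 1) / 2.
  by near: y; move/cvgrPdist_le : (uc x); apply.
have H2 : `|v x - v y| <= e / (C * d0 + 1) / 2.
  by near: y; move/cvgrPdist_le : (vc x); apply.
apply: (@le_trans _ _ ((C * d0 + 1) * (`|u x - u y| + `|v x - v y|))).
  by rewrite ler_wpM2r ?addr_ge0// lerDl.
rewrite -ler_pdivlMl// mulrC.
by move: H1 H2; lra.
Unshelve. all: by end_near. Qed.

Lemma expR_lip (R : realType) (x y : R) : x <= 1 -> y <= 1 ->
  `|expR x - expR y| <= expR 1 * `|x - y|.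
Proof.
wlog xy : x y / y <= x => [wl x1 y1|x1 _].
  have [/wl|/ltW/wl] := leP y x; first exact.
  by rewrite distrC (distrC x); exact.
rewrite (ger0_norm (_ : 0 <= x - y)) ?subr_ge0//.
apply: (@mvt_bound _ _ expR) => //.
  exact/continuous_subspaceT/continuous_expR.
by move=> z /andP[_ zx]; rewrite ger0_norm ?expR_ge0// ler_expR ltW// (lt_le_trans zx).
Qed.

Section quarter.
Variables (R : realType) (a d0 m C : R) (om kap : R -> R).
Variables g1 g2 : R -> R -> R -> R.
Hypotheses (a0 : 0 < a) (d00 : 0 < d0) (m0 : 0 < m) (C0 : 0 <= C).
Hypothesis om_ge : forall l, `|l| <= d0 -> m <= om l.
Hypothesis kap_ge : forall l, `|l| <= d0 -> m <= kap l.
Hypotheses (om_lip : lip1 d0 om) (kap_lip : lip1 d0 kap).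
Hypotheses (g1q : quadratic d0 C g1) (g2q : quadratic d0 C g2).

(* In the scaled polar coordinates [x1 = r cos t], [x2 = - kap r sin t] the
   linear part is a rotation at speed [om] with contraction rate [a]; the
   higher-order terms contribute [r * rad] and [ang] to [r'] and [t'], and
   [excess] is [(ln r)' / t'] minus its value [- a / om] at the equilibrium. *)
Let pol (g : R -> R -> R -> R) (t r l : R) : R :=
  g (r * cos t) (r * - (kap l * sin t)) l / r.

Let rad (t r l : R) : R := cos t * pol g1 t r l + - sin t * (kap l)^-1 * pol g2 t r l.

Let ang (t r l : R) : R := - sin t * pol g1 t r l + - cos t * (kap l)^-1 * pol g2 t r l.

Let excess (t r l : R) : R :=
  (om l * (om l + ang t r l))^-1 * (om l * rad t r l + a * ang t r l).

Let om_gt0 l : `|l| <= d0 -> 0 < om l.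
Proof. by move=> /om_ge; exact: lt_le_trans. Qed.

Let kap_gt0 l : `|l| <= d0 -> 0 < kap l.
Proof. by move=> /kap_ge; exact: lt_le_trans. Qed.

Let cosN1 (t : R) : `|cos t| <= 1.
Proof. by rewrite ler_norml cos_geN1 cos_le1. Qed.

Let sinN1 (t : R) : `|sin t| <= 1.
Proof. by rewrite ler_norml sin_geN1 sin_le1. Qed.

Let polar_bound : exists2 K : R, 1 <= K & forall l l', `|l| <= d0 -> `|l'| <= d0 ->
  kap l <= K /\ `|kap l - kap l'| <= K * `|l - l'|.
Proof.
case: kap_lip => K K0 KP; exists (1 + K); first by rewrite lerDl.
move=> l l' ld l'd; have z : (0 : R) <= (0 : R) <= (0 : R) by rewrite lexx.
have [H1 H2] := KP tt 0 l 0 l' z ld z l'd; split.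
  by rewrite (le_trans (ler_norm _))// (le_trans H1)// lerDr.
apply: (le_trans H2); rewrite subrr normr0 add0r ler_wpM2r// lerDr//.
Qed.

(** Radii up to [r1] keep the point where [g1] and [g2] are controlled. The further cut
    [m / 2 / (D + 1)] keeps [ang] below [m / 2], so the angle always advances and the denominator of
    [excess] stays away from zero; its numerator is linear in the quotients [pol], hence of class
    [slip]. *)
Lemma polar_slip : exists2 r0 : R, 0 < r0 & [/\
  forall t r l, 0 <= r <= r0 -> `|l| <= d0 ->
    `|r * cos t| <= d0 /\ `|r * - (kap l * sin t)| <= d0,
  slip r0 d0 excess &
  forall t r l, 0 <= r <= r0 -> `|l| <= d0 ->
    m / 2 <= om l + ang t r l <= om l + m].
Proof.
have [K K1 KP] := polar_bound.
have K0 : 0 < K := lt_le_trans ltr01 K1.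
pose r1 := d0 / K; have r10 : 0 < r1 by rewrite divr_gt0.
have Kr1 : K * r1 <= d0 by rewrite /r1 mulrC divfK ?gt_eqF.
have pol_slip g : quadratic d0 C g -> slip r1 d0 (pol g).
  move=> gq; apply: (@slip_polar _ _ r1 d0 C K g cos
    (fun t l => - (kap l * sin t))) => // t l l' ld l'd.
  have [H1 H2] := KP l l' ld l'd; split.
    rewrite normrN normrM (gtr0_norm (kap_gt0 ld)) (le_trans _ H1)//.
    by rewrite ler_piMr// ltW// kap_gt0.
  rewrite -opprD normrN -mulrBl normrM (le_trans _ H2)//.
  by rewrite ler_piMr.
have kapV_lip : lip1 d0 (fun l => (kap l)^-1).
  by apply: (lipV m0) kap_lip => _ _ l _; exact: kap_ge.
have sin_lip : lip r1 d0 (fun t _ _ => - sin t : R).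
  by apply: lip_index => t; rewrite normrN.
have cos_lip' : lip r1 d0 (fun t _ _ => - cos t : R).
  by apply: lip_index => t; rewrite normrN.
have rad_slip : slip r1 d0 rad.
  apply: slipD; apply: slipM (pol_slip _ _) => //; first exact: lip_index.
  by apply: lipM => //; exact: lip_param.
have ang_slip : slip r1 d0 ang.
  apply: slipD; apply: slipM (pol_slip _ _) => //.
  by apply: lipM => //; exact: lip_param.
have [D D0 angD] := slip_ler ang_slip.
pose r0 := Num.min r1 (m / 2 / (D + 1)).
have D1 : 0 < D + 1 by rewrite ltr_wpDl.
have r0_gt0 : 0 < r0 by rewrite /r0 lt_min r10 !divr_gt0.
have r01 : r0 <= r1 by rewrite /r0 ge_min lexx.
have ang_le t r l : 0 <= r <= r0 -> `|l| <= d0 -> `|ang t r l| <= m / 2.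
  move=> /andP[r_ge0 rr0] ld; have rr1 := le_trans rr0 r01.
  apply: le_trans (angD _ _ _ _ ld) _; first by rewrite r_ge0.
  have : r <= m / 2 / (D + 1) by rewrite (le_trans rr0)// /r0 ge_min lexx orbT.
  rewrite ler_pdivlMr// mulrDr mulr1 mulrC => H; apply: le_trans H.
  by rewrite lerDl.
have speed t r l : 0 <= r <= r0 -> `|l| <= d0 ->
    m / 2 <= om l + ang t r l <= om l + m.
  move=> rr0 ld; have := ang_le t r l rr0 ld; have := om_ge ld.
  by rewrite ler_norml => ? /andP[? ?]; apply/andP; split; lra.
exists r0 => //; split=> //.
  move=> t r l /andP[r_ge0 rr0] ld.
  have Kr : K * r <= d0.
    by rewrite (le_trans _ Kr1)// ler_wpM2l ?(ltW K0)// (le_trans rr0).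
  have [H1 _] := KP l l ld ld.
  rewrite !normrM normrN normrM (ger0_norm r_ge0) (gtr0_norm (kap_gt0 ld)).
  split; (apply: le_trans Kr; rewrite mulrC ler_wpM2r//).
    exact: le_trans K1.
  by rewrite (le_trans _ H1)// ler_piMr// ltW// kap_gt0.
have om_lip' : lip r0 d0 (fun (_ : R) _ => om) by exact: lip_param.
have ang_slip0 : slip r0 d0 ang := slipW r01 (lexx d0) ang_slip.
apply: slipM.
  have m2 : 0 < m * (m / 2) by rewrite mulr_gt0// divr_gt0.
  apply: (lipV m2) => [t r l rr0 ld|].
    rewrite ler_pM ?divr_ge0 ?(ltW m0)// ?om_ge//.
    by have /andP[] := speed t r l rr0 ld.
  by apply: lipM => //; apply: lipD => //; exact: slip_lip.
apply: slipD; first by apply: slipM => //; exact: slipW rad_slip.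
apply: slipM => //; exists `|a| => // t r l r' l' _ _ _ _.
by split=> //; rewrite subrr normr0 mulr_ge0 ?addr_ge0.
Qed.

Let pol_continuous (g : R -> R -> R -> R) (r0 : R) (rho : R -> R) (l : R) :
  quadratic d0 C g ->
  (forall t r l, 0 <= r <= r0 -> `|l| <= d0 ->
    `|r * cos t| <= d0 /\ `|r * - (kap l * sin t)| <= d0) ->
  `|l| <= d0 -> continuous rho -> (forall t, 0 < rho t <= r0) ->
  continuous (fun t => pol g t (rho t) l).
Proof.
move=> gq bd ld rc rr0 t.
have rr0' s : 0 <= rho s <= r0 by have /andP[/ltW -> ->] := rr0 s.
have gc : continuous (fun s => g (rho s * cos s) (rho s * - (kap l * sin s)) l).
  apply: (quadratic_continuous C0 (ltW d00) gq ld).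
  - by move=> s; have [] := bd s _ _ (rr0' s) ld.
  - by move=> s; have [] := bd s _ _ (rr0' s) ld.
  - by move=> s; apply: cvgM; [exact: rc|exact: continuous_cos].
  - move=> s; apply: cvgM; [exact: rc|apply: cvgN].
    by apply: cvgM; [exact: cvg_cst|exact: continuous_sin].
apply: cvgM; first exact: gc.
by apply: cvgV; [have /andP[/lt0r_neq0] := rr0 t|exact: rc].
Qed.

Let mix_continuous (s1 s2 : R -> R) (r0 : R) (rho : R -> R) (l : R) :
  (forall t r l, 0 <= r <= r0 -> `|l| <= d0 ->
    `|r * cos t| <= d0 /\ `|r * - (kap l * sin t)| <= d0) ->
  `|l| <= d0 -> continuous rho -> (forall t, 0 < rho t <= r0) ->
  continuous s1 -> continuous s2 ->
  continuous (fun t => s1 t * pol g1 t (rho t) l +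
    s2 t * (kap l)^-1 * pol g2 t (rho t) l).
Proof.
move=> bd ld rc rr0 s1c s2c t; apply: cvgD; apply: cvgM.
- exact: s1c.
- exact: (pol_continuous g1q bd ld rc rr0).
- by apply: cvgM; [exact: s2c|exact: cvg_cst].
- exact: (pol_continuous g2q bd ld rc rr0).
Qed.

Lemma polar_continuous (r0 : R) (rho : R -> R) (l : R) :
  (forall t r l, 0 <= r <= r0 -> `|l| <= d0 ->
    `|r * cos t| <= d0 /\ `|r * - (kap l * sin t)| <= d0) ->
  (forall t r l, 0 <= r <= r0 -> `|l| <= d0 ->
    m / 2 <= om l + ang t r l <= om l + m) ->
  `|l| <= d0 -> continuous rho -> (forall t, 0 < rho t <= r0) ->
  continuous (fun t => om l + ang t (rho t) l) /\
  continuous (fun t => excess t (rho t) l).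
Proof.
move=> bd speed ld rc rr0.
have sinN_c : continuous (fun t : R => - sin t).
  by move=> t; apply: cvgN; exact: continuous_sin.
have cosN_c : continuous (fun t : R => - cos t).
  by move=> t; apply: cvgN; exact: continuous_cos.
have ang_c : continuous (fun t => ang t (rho t) l).
  exact: mix_continuous bd ld rc rr0 sinN_c cosN_c.
have rad_c : continuous (fun t => rad t (rho t) l).
  exact: mix_continuous bd ld rc rr0 (@continuous_cos R) sinN_c.
have speed_c : continuous (fun t => om l + ang t (rho t) l).
  by move=> t; apply: cvgD; [exact: cvg_cst|exact: ang_c].
split=> // t; apply: cvgM.
  apply: cvgV; last by apply: cvgM; [exact: cvg_cst|exact: speed_c].
  have rr0t : 0 <= rho t <= r0 by have /andP[/ltW -> ->] := rr0 t.
  have /andP[s0 _] := speed t _ _ rr0t ld.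
  by rewrite mulf_neq0// gt_eqF ?om_gt0// (lt_le_trans _ s0)// divr_gt0.
by apply: cvgD; apply: cvgM; solve [exact: cvg_cst|exact: rad_c|exact: ang_c].
Qed.

(* The clamps make the field of the angular equation globally bounded and
   Lipschitz; they are inactive on the solutions for [0 <= t <= 2]. *)
Let rho (r l t y : R) : R :=
  r * expR (- (a / om l) * clamp 0 2 t + clamp (- 1) 1 y).

Let clamp02 (t : R) : 0 <= clamp 0 2 t <= 2.
Proof. exact: clamp_itv. Qed.

Let expo_le1 l t y : `|l| <= d0 -> - (a / om l) * clamp 0 2 t + clamp (- 1) 1 y <= 1.
Proof.
move=> ld; have N1 : - 1 <= 1 :> R by lra.
have /andP[_ y1] := clamp_itv y N1; have /andP[t0 _] := clamp02 t.
have : 0 <= a / om l * clamp 0 2 t by rewrite mulr_ge0// divr_ge0 ?ltW// om_gt0.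
by rewrite mulNr; lra.
Qed.

Let rho_le r l t y : 0 <= r -> `|l| <= d0 -> 0 <= rho r l t y <= r * expR 1.
Proof.
move=> r0 ld; rewrite mulr_ge0 ?expR_ge0//=.
by rewrite ler_wpM2l// ler_expR expo_le1.
Qed.

Let rho_dist_y r l t y z : 0 <= r -> `|l| <= d0 ->
  `|rho r l t y - rho r l t z| <= r * expR 1 * `|y - z|.
Proof.
move=> r0 ld; rewrite -mulrBr normrM ger0_norm// -mulrA ler_wpM2l//.
apply: le_trans (expR_lip (expo_le1 _ _ ld) (expo_le1 _ _ ld)) _.
by rewrite ler_wpM2l ?expR_ge0// opprD addrACA subrr add0r clamp_lip.
Qed.

(** The factor [r] in front of the exponential is what makes the dependence on [l] degenerate at the
    origin. *)
Let rho_dist : exists2 L : R, 0 <= L & forall r l r' l' t y, 0 <= r -> `|l| <= d0 ->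
  0 <= r' -> `|l'| <= d0 ->
  `|rho r l t y - rho r' l' t y| <= L * (`|r - r'| + (r + r') * `|l - l'|).
Proof.
have omV_lip : lip1 d0 (fun l => (om l)^-1).
  by apply: (lipV m0) om_lip => _ _ l _; exact: om_ge.
case: omV_lip => L L0 LP; exists (expR 1 * (1 + 2 * a * L)).
  by rewrite mulr_ge0 ?expR_ge0// addr_ge0// !mulr_ge0// ltW.
move=> r l r' l' t y r0 ld r'0 l'd.
have z : (0 : R) <= (0 : R) <= (0 : R) by rewrite lexx.
have [_] := LP tt 0 l 0 l' z ld z l'd; rewrite subrr normr0 add0r => omd.
have eqd : rho r l t y - rho r' l' t y = (r - r') *
    expR (- (a / om l) * clamp 0 2 t + clamp (- 1) 1 y) +
  r' * (expR (- (a / om l) * clamp 0 2 t + clamp (- 1) 1 y) -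
    expR (- (a / om l') * clamp 0 2 t + clamp (- 1) 1 y)) by rewrite /rho; ring.
rewrite eqd; apply: le_trans (ler_normD _ _) _; rewrite !normrM.
have E1 : `|expR (- (a / om l) * clamp 0 2 t + clamp (- 1) 1 y)| <= expR 1.
  by rewrite ger0_norm ?expR_ge0// ler_expR expo_le1.
have := expR_lip (expo_le1 t y ld) (expo_le1 t y l'd).
rewrite (_ : _ - (_ + _) = a * clamp 0 2 t * - ((om l)^-1 - (om l')^-1)); last by ring.
rewrite !normrM normrN (gtr0_norm a0).
have /andP[t0 t2] := clamp02 t; rewrite (ger0_norm t0) (ger0_norm r'0).
set e1 := `|expR _ - expR _| => E2.
have P : 0 <= expR 1 * (2 * a * L) * `|r - r'|.
  by rewrite !mulr_ge0 ?expR_ge0// ltW.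
have Q : 0 <= expR 1 * r * `|l - l'| by rewrite !mulr_ge0 ?expR_ge0.
have Q' : 0 <= expR 1 * r' * `|l - l'| by rewrite !mulr_ge0 ?expR_ge0.
have S : 0 <= expR 1 * (2 * a * L) * r * `|l - l'|.
  by rewrite !mulr_ge0 ?expR_ge0// ltW.
have H1 : `|r - r'| * `|expR (- (a / om l) * clamp 0 2 t + clamp (- 1) 1 y)| <=
  expR 1 * `|r - r'| by rewrite mulrC ler_wpM2r.
have H2 : r' * e1 <= r' * (expR 1 * (a * 2 * (L * `|l - l'|))).
  rewrite ler_wpM2l//; apply: (le_trans E2); rewrite ler_wpM2l ?expR_ge0//.
  by rewrite ler_pM ?mulr_ge0 ?(ltW a0)// ler_wpM2l// ltW.
by lra.
Qed.

Let rho_continuous r l y : continuous y -> continuous (fun t => rho r l t (y t)).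
Proof.
move=> yc t; apply: cvgM; first exact: cvg_cst.
apply: continuous_comp; last exact: continuous_expR.
have clamp_cts c d : continuous (@clamp R c d).
  by apply: (@lipschitz_cts _ _ 1) => u v; rewrite mul1r clamp_lip.
apply: cvgD; first by apply: cvgM; [exact: cvg_cst|exact: clamp_cts].
by apply: continuous_comp; [exact: yc|exact: clamp_cts].
Qed.

(** The unknown [n] is the logarithm of the radius minus its value along the linear flow: it starts
    at [0], and its equation has right-hand side [excess], of order [r]. Its dependence on [(r, l)]
    comes from [picard_compare], and the degenerate factor is inherited from [excess] and [rho]. *)
Lemma angular_solutions (r0 : R) : 0 < r0 ->
  (forall t r l, 0 <= r <= r0 -> `|l| <= d0 ->
    `|r * cos t| <= d0 /\ `|r * - (kap l * sin t)| <= d0) ->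
  (forall t r l, 0 <= r <= r0 -> `|l| <= d0 ->
    m / 2 <= om l + ang t r l <= om l + m) ->
  slip r0 d0 excess ->
  exists r1 (n : R -> R -> R -> R), [/\ 0 < r1, r1 * expR 1 <= r0,
    slip r1 d0 (fun (_ : unit) r l => n r l (pi / 2)) &
    forall r l, 0 <= r <= r1 -> `|l| <= d0 -> [/\ continuous (n r l), n r l 0 = 0,
      forall t, `|n r l t| <= 1 & forall t : R, 0 < t < 2 ->
        is_derive t 1 (n r l) (excess t (rho r l t (n r l t)) l)]].
Proof.
move=> r00 bd speed ex_slip.
have [D D0 exD] := slip_ler ex_slip; case: (ex_slip) => D' D'0 exD'.
(* The first bound keeps the radius below [r0], the clamped exponent being at most [1]. The second
   makes the field at most [1/4] in size and [1/4]-Lipschitz in [y], whence [|n| <= 1/2] and the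
   clamp on [y] is inactive. *)
pose r1 := Num.min (r0 / expR 1) (4^-1 / (D * expR 1 + D' * expR 1 + 1)).
have den0 : 0 < D * expR 1 + D' * expR 1 + 1.
  by rewrite ltr_wpDl// addr_ge0// mulr_ge0// expR_ge0.
have r10 : 0 < r1 by rewrite /r1 lt_min !divr_gt0 ?expR_gt0.
have r1r0 : r1 * expR 1 <= r0.
  by rewrite -ler_pdivlMr ?expR_gt0// /r1 ge_min lexx.
have r1D : D * (r1 * expR 1) <= 4^-1 /\ D' * (r1 * expR 1) <= 4^-1.
  have : r1 <= 4^-1 / (D * expR 1 + D' * expR 1 + 1) by rewrite /r1 ge_min lexx orbT.
  rewrite ler_pdivlMr//.
  have : 0 <= D * (r1 * expR 1) by rewrite !mulr_ge0 ?expR_ge0// ltW.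
  have : 0 <= D' * (r1 * expR 1) by rewrite !mulr_ge0 ?expR_ge0// ltW.
  by have := ltW r10; split; lra.
have rho_r0 r l t y : 0 <= r <= r1 -> `|l| <= d0 -> 0 <= rho r l t y <= r0.
  move=> /andP[r_ge0 rr1] ld; have /andP[-> /= h] := rho_le t y r_ge0 ld.
  by rewrite (le_trans h)// (le_trans _ r1r0)// ler_wpM2r// expR_ge0.
pose h r l t y := excess t (rho r l t y) l.
have hB r l t y : 0 <= r <= r1 -> `|l| <= d0 -> `|h r l t y| <= D * (r * expR 1).
  move=> rr1 ld; apply: le_trans (exD _ _ _ (rho_r0 _ _ _ _ rr1 ld) ld) _.
  have /andP[r_ge0 _] := rr1.
  by rewrite ler_wpM2l//; have /andP[] := rho_le t y r_ge0 ld.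
have hB4 r l t y : 0 <= r <= r1 -> `|l| <= d0 -> `|h r l t y| <= 4^-1.
  move=> rr1 ld; apply: le_trans (hB _ _ _ _ rr1 ld) _.
  apply: le_trans r1D.1; rewrite ler_wpM2l// ler_wpM2r ?expR_ge0//.
  by have /andP[] := rr1.
have hl r l t y z : 0 <= r <= r1 -> `|l| <= d0 ->
    `|h r l t y - h r l t z| <= 4^-1 * `|y - z|.
  move=> rr1 ld; have /andP[r_ge0 rr] := rr1.
  have [_] := exD' t _ _ _ _ (rho_r0 _ _ t y rr1 ld) ld (rho_r0 _ _ t z rr1 ld) ld.
  rewrite subrr normr0 mulr0 addr0 => /le_trans; apply.
  apply: le_trans (ler_wpM2l D'0 (rho_dist_y t y z r_ge0 ld)) _.
  rewrite mulrA ler_wpM2r//; apply: le_trans r1D.2.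
  by rewrite ler_wpM2l// ler_wpM2r// expR_ge0.
have hc r l y : 0 <= r <= r1 -> `|l| <= d0 -> continuous y ->
    continuous (fun t => h r l t (y t)).
  move=> rr1 ld yc; have /andP[+ rr] := rr1.
  (* [polar_continuous] asks for a positive radius; at [r = 0] the bound [hB] makes the field
     vanish. *)
  rewrite le_eqVlt => /predU1P[r_eq0|r_gt0].
    have -> : (fun t => h r l t (y t)) = fun=> 0.
      apply/funext => t; apply/eqP; rewrite -normr_le0.
      by rewrite (le_trans (hB _ _ _ _ rr1 ld))// -r_eq0 mul0r mulr0.
    by move=> t; exact: cvg_cst.
  have rho_pos t : 0 < rho r l t (y t) <= r0.
    have /andP[_ ->] := rho_r0 r l t (y t) rr1 ld.
    by rewrite mulr_gt0// expR_gt0.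
  by have [] := polar_continuous bd speed ld (@rho_continuous r l y yc) rho_pos.
have /choice[n nP] : forall rl : R * R, exists n : R -> R,
    0 <= rl.1 <= r1 -> `|rl.2| <= d0 -> [/\ continuous n, n 0 = 0,
      forall t, `|n t| <= 2 * (D * (rl.1 * expR 1)) & forall t : R, 0 < t < 2 ->
        is_derive t 1 n (h rl.1 rl.2 t (n t))].
  move=> [r l] /=; have [rr1|nrr1] := boolP (0 <= r <= r1); last by exists id.
  have [ld|nld] := boolP (`|l| <= d0); last by exists id.
  have [n nP] := @picard R (h r l) (D * (r * expR 1)) (fun y => @hc r l y rr1 ld)
    (fun t y => hB r l t y rr1 ld) (fun t y z => hl r l t y z rr1 ld).
  by exists n.
exists r1, (fun r l => n (r, l)); split=> //.
  have [L L0 rhoL] := rho_dist.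
  exists (4 * (D' * (L + 2 * expR 1))).
    by rewrite !mulr_ge0// addr_ge0// mulr_ge0// expR_ge0.
  move=> _ r l r' l' rr1 ld r'r1 l'd; split.
    have z : (0 : R) <= (0 : R) <= r1 by rewrite lexx ltW.
    have [_ _ nb _] := nP (0, l) z ld.
    by apply/eqP; rewrite -normr_le0; have := nb (pi / 2); rewrite mul0r !mulr0.
  have [n1c n10 _ n1d] := nP (r, l) rr1 ld.
  have [n2c n20 _ n2d] := nP (r', l') r'r1 l'd.
  have /andP[r_ge0 _] := rr1; have /andP[r'_ge0 _] := r'r1.
  rewrite -mulrA.
  apply: (picard_compare (fun t y z => hl r l t y z rr1 ld) n1c n2c n10 n20 n1d n2d).
  - move=> t _ /=; have := rho_r0 _ _ t (n (r', l') t) rr1 ld.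
    have := rho_r0 _ _ t (n (r', l') t) r'r1 l'd => R2 R1.
    have [_] := exD' t _ _ _ _ R1 ld R2 l'd.
    move=> /le_trans; apply; rewrite -mulrA ler_wpM2l//.
    have := rhoL r l r' l' t (n (r', l') t) r_ge0 ld r'_ge0 l'd.
    have /andP[_ b1] := rho_le t (n (r', l') t) r_ge0 ld.
    have /andP[_ b2] := rho_le t (n (r', l') t) r'_ge0 l'd.
    set X := rho r l _ _ in b1 *; set Y := rho r' l' _ _ in b2 *.
    have : (X + Y) * `|l - l'| <= (r * expR 1 + r' * expR 1) * `|l - l'|.
      by rewrite ler_wpM2r// lerD.
    have : 0 <= expR 1 * `|r - r'| by rewrite mulr_ge0 ?expR_ge0.
    have : 0 <= expR 1 * (r + r') * `|l - l'| by rewrite !mulr_ge0 ?addr_ge0 ?expR_ge0.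
    by lra.
  - by rewrite divr_ge0 ?pi_ge0//= ltW// pihalf_lt2.
move=> r l rr1 ld; have [nc n0 nb nd] := nP (r, l) rr1 ld; split=> // t.
apply: (le_trans (nb t)) => /=; have /andP[r_ge0 rr] := rr1.
have : D * (r * expR 1) <= D * (r1 * expR 1).
  by rewrite ler_wpM2l// ler_wpM2r// expR_ge0.
by have := r1D.1; lra.
Qed.

Let rho_derive r l (n : R -> R) (t dn : R) : 0 < t < 2 -> (forall s, `|n s| <= 1) ->
  is_derive t 1 n dn ->
  is_derive t 1 (fun s => rho r l s (n s)) (rho r l t (n t) * (- (a / om l) + dn)).
Proof.
move=> /andP[t0 t2] n1 nd.
have nE s : clamp (- 1) 1 (n s) = n s by rewrite clamp_id// -ler_norml.
apply: (@near_eq_is_derive _ _ _ (fun s => r * expR (- (a / om l) * s + n s))).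
  near=> s; rewrite /rho nE clamp_id//; apply/andP; split.
    by near: s; exact: lt_le_nbhsr.
  by near: s; exact: lt_le_nbhsl.
have lin : is_derive t 1 (fun s => - (a / om l) * s + n s) (- (a / om l) + dn).
  apply: is_deriveD; have := is_deriveZ (- (a / om l)) (@is_derive_id _ R t 1).
  by rewrite [_ *: 1]mulr1.
have := is_deriveZ r (is_derive1_comp (is_derive_expR _) lin).
move=> /is_derive_eq; apply; rewrite [_ *: _]mulrA /rho nE clamp_id//.
by rewrite (ltW t0) ltW.
Unshelve. all: by end_near. Qed.

(** The equation in the angle is turned back into one in time: [tau], the integral of the inverse
    angular speed, tells when an angle is reached, and [th] inverts it. At the exit the distance is
    measured along the other axis, which brings in the factor [kap l]. *)
Lemma quarter_map : exists (r1 : R) (e : R -> R -> R),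
  [/\ 0 < r1, slip r1 d0 (fun _ : unit => e) & forall r l, 0 < r <= r1 -> `|l| <= d0 ->
  exists (T : R) (y1 y2 : R -> R), [/\ 0 < T, continuous y1, continuous y2,
    [/\ y1 0 = r, y2 0 = 0, y1 T = 0 &
      y2 T = - (r * expR (ln (kap l) - a / om l * (pi / 2) + e r l))] &
    forall t, 0 < t < T -> [/\ 0 < y1 t, y2 t < 0,
      is_derive t 1 y1 (- a * y1 t + om l / kap l * y2 t + g1 (y1 t) (y2 t) l) &
      is_derive t 1 y2 (- (kap l * om l) * y1 t - a * y2 t + g2 (y1 t) (y2 t) l)]]].
Proof.
have [r0 r00 [bd ex_slip speed]] := polar_slip.
have [r1 [n [r10 r1r0 n_slip nP]]] := angular_solutions r00 bd speed ex_slip.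
exists r1, (fun r l => n r l (pi / 2)); split=> // r l /andP[r_gt0 rr1] ld.
have rr1' : 0 <= r <= r1 by rewrite ltW.
have [nc n0 n1 nd] := nP r l rr1' ld.
pose q t := rho r l t (n r l t).
have qc : continuous q := @rho_continuous r l _ nc.
have q_gt0 t : 0 < q t by rewrite mulr_gt0// expR_gt0.
have q_r0 t : 0 < q t <= r0.
  rewrite q_gt0; have /andP[_ h] := rho_le t (n r l t) (ltW r_gt0) ld.
  by rewrite (le_trans h)// (le_trans _ r1r0)// ler_wpM2r// expR_ge0.
pose sp t := om l + ang t (q t) l.
have sp_b t : m / 2 <= sp t <= om l + m.
  by apply: speed => //; have /andP[/ltW -> ->] := q_r0 t.
have sp_gt0 t : 0 < sp t.
  by have /andP[h _] := sp_b t; apply: lt_le_trans h; rewrite divr_gt0.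
have [sp_c _] := polar_continuous bd speed ld qc q_r0.
have spV_c : continuous (fun t => (sp t)^-1).
  by move=> t; apply: cvgV; [rewrite gt_eqF|exact: sp_c].
have [tau [tau0 tauD]] := primitive spV_c.
have omm : 0 < (om l + m)^-1 by rewrite invr_gt0 addr_gt0// om_gt0.
have spV_ge t : (om l + m)^-1 <= (sp t)^-1.
  by have /andP[_ h] := sp_b t; rewrite lef_pV2 ?posrE ?sp_gt0 ?addr_gt0 ?om_gt0.
have [th [tauK thK th_inc thD]] := inverse_of_expanding omm tauD spV_ge.
pose T := tau (pi / 2).
have pih0 : 0 < pi / 2 :> R by rewrite divr_gt0 ?pi_gt0.
have th0 : th 0 = 0 by rewrite -tau0 tauK.
have thT : th T = pi / 2 by rewrite tauK.
have T0 : 0 < T.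
  rewrite ltNge le_eqVlt; apply/negP => /orP[/eqP T0|/th_inc].
    by move: pih0; rewrite -thT T0 th0 ltxx.
  by rewrite thT th0 => /(lt_trans pih0); rewrite ltxx.
have thc : continuous th by move=> t; exact: is_derive_continuous (thD t).
have compc (f : R -> R) : continuous f -> continuous (fun t => f (th t)).
  by move=> fc t; apply: continuous_comp; [exact: thc|exact: fc].
pose z1 t := q t * cos t; pose z2 t := q t * - (kap l * sin t).
have z1c : continuous z1.
  by move=> t; apply: cvgM; [exact: qc|exact: continuous_cos].
have z2c : continuous z2.
  move=> t; apply: cvgM; [exact: qc|apply: cvgN].
  by apply: cvgM; [exact: cvg_cst|exact: continuous_sin].
have kap0 := kap_gt0 ld; have om0 := om_gt0 ld.
exists T, (fun t => z1 (th t)), (fun t => z2 (th t)); split.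
- exact: T0.
- exact: compc z1c.
- exact: compc z2c.
- rewrite th0 thT /z1 /z2 cos_pihalf sin_pihalf cos0 sin0 !mulr0 !mulr1 oppr0 mulr0.
  have c00 : clamp 0 2 0 = 0 :> R by rewrite clamp_id// lexx ler0n.
  have cpi : clamp 0 2 (pi / 2) = pi / 2 :> R.
    by rewrite clamp_id// ltW//= ltW// pihalf_lt2.
  have cn t : clamp (- 1) 1 (n r l t) = n r l t by rewrite clamp_id// -ler_norml.
  split; [|by []|by []|]; rewrite /q /rho.
    by rewrite c00 n0 clamp_id ?mulr0 ?addr0 ?expR0 ?mulr1//; apply/andP; split; lra.
  have -> : expR (ln (kap l) - a / om l * (pi / 2) + n r l (pi / 2)) =
      expR (- (a / om l) * (pi / 2) + n r l (pi / 2)) * kap l.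
    by rewrite -addrA expRD lnK ?posrE// mulrC mulNr.
  by rewrite cpi cn; ring.
move=> t /andP[t0 tT]; set x := th t.
have x0 : 0 < x by rewrite -th0; exact: th_inc.
have xpi : x < pi / 2 by rewrite -thT; exact: th_inc.
have x2 : x < 2 := lt_trans xpi (pihalf_lt2 _).
have cx0 : 0 < cos x.
  by apply: cos_gt0_pihalf; rewrite xpi andbT (lt_trans _ x0)// oppr_lt0.
have sx0 : 0 < sin x by apply: sin_gt0_pihalf; rewrite x0.
have xD : is_derive t 1 th (sp x) by have := thD t; rewrite invrK.
have x02 : 0 < x < 2 by rewrite x0.
have qD : is_derive x 1 q (q x * (- (a / om l) + excess x (q x) l)).
  exact: rho_derive (nd _ x02).
(* Multiplying the logarithmic slope in the angle by the angular speed recovers the radial rate in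
   time; [excess] is defined so that this holds. *)
have qS : (- (a / om l) + excess x (q x) l) * sp x = - a + rad x (q x) l.
  rewrite /excess -/(sp x).
  have spx : sp x != 0 by rewrite gt_eqF.
  have angE : ang x (q x) l = sp x - om l by rewrite /sp addrC addKr.
  by rewrite angE; field; rewrite spx gt_eqF.
have g1E : g1 (z1 x) (z2 x) l = q x * pol g1 x (q x) l.
  by rewrite /pol mulrC divfK// gt_eqF.
have g2E : g2 (z1 x) (z2 x) l = q x * pol g2 x (q x) l.
  by rewrite /pol mulrC divfK// gt_eqF.
have cs : cos x ^+ 2 = 1 - sin x ^+ 2 by rewrite cos2sin2.
have kn0 : kap l != 0 by rewrite gt_eqF.
split.
- exact: mulr_gt0 (q_gt0 x) cx0.
- by rewrite /z2 mulrN oppr_lt0; exact: mulr_gt0 (q_gt0 x) (mulr_gt0 kap0 sx0).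
- have := is_derive1_comp (is_deriveM qD (is_derive_cos x)) xD.
  move=> /is_derive_eq; apply; rewrite g1E /z1 /z2.
  rewrite /GRing.scale/= mulrDl.
  have -> : cos x * (q x * (- (a / om l) + excess x (q x) l)) * sp x =
    cos x * q x * ((- (a / om l) + excess x (q x) l) * sp x) by ring.
  rewrite qS /sp /rad /ang.
  move: (pol g1 _ _ _) (pol g2 _ _ _) => p1 p2.
  move: (cos x) (sin x) (q x) cs => c s r' cs.
  apply/eqP; rewrite -subr_eq0; apply/eqP.
  (* Up to the Pythagorean identity the two sides agree as rational expressions, so their difference
     is exhibited as a multiple of it. *)
  transitivity (r' * p1 * (c ^+ 2 + s ^+ 2 - 1)); first by field.
  by rewrite cs; ring.
- have sinD := is_deriveN (is_deriveZ (kap l) (is_derive_sin x)).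
  have := is_derive1_comp (is_deriveM qD sinD) xD.
  move=> /is_derive_eq; apply; rewrite g2E /z1 /z2.
  rewrite /GRing.scale/= mulrDl.
  have -> : - (kap l * sin x) * (q x * (- (a / om l) + excess x (q x) l)) * sp x =
    - (kap l * sin x) * q x * ((- (a / om l) + excess x (q x) l) * sp x) by ring.
  rewrite qS /sp /rad /ang.
  move: (pol g1 _ _ _) (pol g2 _ _ _) => p1 p2.
  move: (cos x) (sin x) (q x) cs => c s r' cs.
  apply/eqP; rewrite -subr_eq0; apply/eqP.
  transitivity (r' * p2 * (c ^+ 2 + s ^+ 2 - 1)); first by field.
  by rewrite cs; ring.
Qed.

End quarter.

(** * Concatenation of arcs *)

Lemma region_inj (R : realType) (i j : quadrant) (x : 'cV[R]_2) :
  region i x -> region j x -> i = j.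
Proof. by case: i; case: j => //= -[? ?] [? ?]; exfalso; lra. Qed.

(** Finitely many balls cover the segment, and each meets [S] at most in its center. *)
Lemma locally_finite (R : realType) (S : set R) (u v : R) :
  (forall t, exists e, 0 < e /\ forall s, `|s - t| < e -> S s -> s = t) ->
  finite_set (`[u, v] `&` S).
Proof.
move=> /choice[e eP].
have ballO t : [set: R] t -> open (ball t (e t)).
  by move=> _; apply: ball_open; exact: (eP t).1.
have := @segment_compact _ u v; rewrite compact_cover => cov.
have [|D _ DP] := cov R [set: R] (fun t => ball t (e t)) ballO.
  move=> t _; exists t => //; apply: ballxx.
  exact: (eP t).1.
apply: sub_finite_set (finite_fset D).
move=> t [tuv St]; have [s sD] := DP _ tuv.
rewrite /ball/= distrC => ts.
have [_ H] := eP s; rewrite (H t)//.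
Qed.

(** A local condition, stable under translation and under changes of the curve away from [t]. When
    the regions before and after differ, [t] is a crossing time and no derivative is required. *)
Definition flows_at (R : realType) (f : quadrant -> 'cV[R]_2 -> 'cV[R]_2)
    (x : R -> 'cV[R]_2) (t : R) : Prop :=
  x t != 0 /\ exists (e : R) (i j : quadrant), [/\ 0 < e,
    forall s, t - e < s < t -> region i (x s),
    forall s, t < s < t + e -> region j (x s) &
    i = j -> region i (x t) /\ is_derive t 1 x (f i (x t))].

Lemma flows_at_eq (R : realType) (f : quadrant -> 'cV[R]_2 -> 'cV[R]_2)
    (x y : R -> 'cV[R]_2) (t e : R) : 0 < e ->
  (forall s, t - e < s < t + e -> x s = y s) -> flows_at f x t -> flows_at f y t.
Proof.
move=> e0 xy [xt0 [e' [i [j [e'0 xi xj xd]]]]].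
have xyt : x t = y t by apply: xy; apply/andP; split; lra.
split; first by rewrite -xyt.
exists (Num.min e e'), i, j; split.
- by rewrite lt_min e0.
- move=> s /andP[]; rewrite ltrBlDr -ltrBlDl lt_min => /andP[? ?] ?.
  by rewrite -xy; [apply: xi|]; apply/andP; split; lra.
- move=> s /andP[?]; rewrite -ltrBlDl lt_min => /andP[? ?].
  by rewrite -xy; [apply: xj|]; apply/andP; split; lra.
- move=> /xd; rewrite xyt => -[? xD]; split => //.
  apply: near_eq_is_derive xD; near=> s; apply: xy; apply/andP; split.
    by near: s; apply: lt_nbhsr; lra.
  by near: s; apply: lt_nbhsl; lra.
Unshelve. all: by end_near. Qed.

Lemma is_derive_translate (R : realType) (V : normedModType R) (x : R -> V) (t c : R)
    (dx : V) : is_derive (t - c) 1 x dx -> is_derive t 1 (fun s => x (s - c)) dx.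
Proof.
have E : (fun h : R => h^-1 *: (((fun s => x (s - c)) \o shift t) (h *: (1 : R)) -
    x (t - c))) = (fun h : R => h^-1 *: ((x \o shift (t - c)) (h *: (1 : R)) -
    x (t - c))) by apply/funext => h; rewrite /= addrA.
by move=> [xd xD]; split; [rewrite /derivable E|rewrite /derive E].
Qed.

Lemma flows_at_translate (R : realType) (f : quadrant -> 'cV[R]_2 -> 'cV[R]_2)
    (x : R -> 'cV[R]_2) (t c : R) :
  flows_at f x (t - c) -> flows_at f (fun s => x (s - c)) t.
Proof.
move=> [xt0 [e [i [j [e0 xi xj xd]]]]]; split=> //; exists e, i, j; split=> //.
- by move=> s /andP[? ?]; apply: xi; apply/andP; split; lra.
- by move=> s /andP[? ?]; apply: xj; apply/andP; split; lra.
- by move=> /xd[? ?]; split=> //; exact: is_derive_translate.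
Qed.

(** Around any [t] the curve stays in one region before [t] and in one after it, so no other nearby
    time is a crossing; crossing times are thus isolated. Disjointness of the regions makes the
    field to follow unambiguous. *)
Lemma flows_switched (R : realType) (f : quadrant -> 'cV[R]_2 -> 'cV[R]_2)
    (x : R -> 'cV[R]_2) :
  continuous x -> (forall t, flows_at f x t) -> switched_solution f x.
Proof.
move=> xc xf; split=> //.
- move=> u v; apply: locally_finite => t.
  have [_ [e [i [j [e0 xi xj _]]]]] := xf t.
  exists e; split=> // s st [_ [k [l [kl xk xl]]]].
  apply/eqP; apply: contraPT kl => s_neq_t.
  have [q sq] : exists q, \forall r \near s, region q (x r).
    move: st; rewrite ltr_norml => /andP[st1 st2].
    move: s_neq_t; rewrite neq_lt => /orP[st|ts].
      exists i; near=> r; apply: xi; apply/andP; split; near: r.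
        by apply: lt_nbhsr; lra.
      exact: lt_nbhsl.
    exists j; near=> r; apply: xj; apply/andP; split; near: r.
      exact: lt_nbhsr.
    by apply: lt_nbhsl; lra.
  have kq : k = q.
    near s^'- => r; apply: (@region_inj _ _ _ (x r)).
      by near: r.
    by near: r; apply: cvg_within.
  have lq : l = q.
    near s^'+ => r; apply: (@region_inj _ _ _ (x r)).
      by near: r.
    by near: r; apply: cvg_within.
  by apply; rewrite kq lq.
- move=> t nct; have [xt0 [e [i [j [e0 xi xj xd]]]]] := xf t.
  have ij : i = j.
    apply: contrapT => ij; apply: nct; split => //; exists i, j; split => //.
      near=> s; apply: xi; apply/andP; split=> //; near: s.
      by apply: nbhs_left_gt; lra.
    near=> s; apply: xj; apply/andP; split=> //; near: s.
    by apply: nbhs_right_lt; lra.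
  have [xi' xD] := xd ij; split.
    by move=> k xk; rewrite (region_inj xk xi').
  by move=> xt; rewrite xt eqxx in xt0.
Unshelve. all: by end_near. Qed.

(** The curve is total, but only its restriction to [[0, T]] counts. The ends are exempt from the
    equation; the regions recorded next to them decide whether a junction is a crossing. *)
Definition arc (R : realType) (f : quadrant -> 'cV[R]_2 -> 'cV[R]_2)
    (z : R -> 'cV[R]_2) (T : R) (i j : quadrant) : Prop :=
  [/\ 0 < T, continuous z, forall t, 0 < t < T -> flows_at f z t &
    exists2 e : R, 0 < e & (forall s, 0 < s < e -> region i (z s)) /\
      (forall s, T - e < s < T -> region j (z s))].

Lemma arc_concat (R : realType) (f : quadrant -> 'cV[R]_2 -> 'cV[R]_2)
    (z1 z2 : R -> 'cV[R]_2) (T1 T2 : R) (i j k l : quadrant) :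
  arc f z1 T1 i j -> arc f z2 T2 k l -> j <> k -> z1 T1 = z2 0 -> z1 T1 != 0 ->
  exists z : R -> 'cV[R]_2, [/\ arc f z (T1 + T2) i l,
    forall t, t <= T1 -> z t = z1 t & forall t, T1 <= t -> z t = z2 (t - T1)].
Proof.
move=> [T10 z1c z1f [e1 e10 [z1i z1j]]] [T20 z2c z2f [e2 e20 [z2k z2l]]] jk z12 z1T.
(* With a minimum and a maximum in place of a case distinction, continuity follows by composition;
   [z2 0] cancels whichever summand is frozen. *)
pose z t := z1 (Num.min t T1) + z2 (Num.max (t - T1) 0) - z2 0.
have zl t : t <= T1 -> z t = z1 t.
  move=> tT; rewrite /z min_l// max_r ?subr_le0//.
  by rewrite addrK.
have zr t : T1 <= t -> z t = z2 (t - T1).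
  move=> tT; rewrite /z min_r// max_l ?subr_ge0//.
  by rewrite z12 addrC addKr.
have e120 : 0 < Num.min (Num.min e1 e2) (Num.min T1 T2).
  by rewrite !lt_min e10 e20 T10.
set e := Num.min _ _ in e120.
have [ee1 ee2 eT1 eT2] : [/\ e <= e1, e <= e2, e <= T1 & e <= T2].
  by rewrite /e !ge_min !lexx !orbT.
exists z; split=> //; split; first exact: addr_gt0.
- have shc : continuous (fun t : R => t - T1).
    by move=> t; apply: cvgB; [exact: cvg_id|exact: cvg_cst].
  move=> t; apply: cvgB; last exact: cvg_cst.
  apply: cvgD.
    apply: continuous_comp; last exact: z1c.
    by apply: continuous_min; [exact: cvg_id|exact: cvg_cst].
  apply: continuous_comp; last exact: z2c.
  by apply: continuous_max; [exact: shc|exact: cvg_cst].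
- move=> t /andP[t0 tT]; have [tT1|T1t|tT1] := ltgtP t T1.
  + apply: (@flows_at_eq _ _ z1 _ _ (T1 - t)); rewrite ?subr_gt0//.
      by move=> s /andP[_ ?]; rewrite zl//; lra.
    by apply: z1f; rewrite t0.
  + apply: (@flows_at_eq _ _ (fun s => z2 (s - T1)) _ _ (t - T1)); rewrite ?subr_gt0//.
      by move=> s /andP[? _]; rewrite zr//; lra.
    by apply/flows_at_translate/z2f; apply/andP; split; lra.
  + rewrite tT1; split; first by rewrite zl.
    exists e, j, k; split=> //.
      move=> s /andP[? ?]; rewrite zl; last by lra.
      by apply: z1j; apply/andP; split; lra.
    move=> s /andP[? ?]; rewrite zr; last by lra.
    by apply: z2k; apply/andP; split; lra.
- exists e => //; split.
    move=> s /andP[? ?]; rewrite zl; last by lra.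
    by apply: z1i; apply/andP; split; lra.
  move=> s /andP[? ?]; rewrite zr; last by lra.
  by apply: z2l; apply/andP; split; lra.
Qed.

(** The floor in the periodic extension hides its regularity at multiples of [T]. Locally the
    extension is a translate of [zz], two copies of the arc joined by [arc_concat], which already
    treats the junction. *)
Lemma arc_periodic (R : realType) (f : quadrant -> 'cV[R]_2 -> 'cV[R]_2)
    (z : R -> 'cV[R]_2) (T : R) (i j : quadrant) :
  arc f z T i j -> i <> j -> z T = z 0 -> z 0 != 0 ->
  exists x : R -> 'cV[R]_2,
    periodic_solution f x /\ forall t, 0 <= t < T -> x t = z t.
Proof.
move=> za ij zT z0; have [T0 _ _ _] := za.
have [|//|zz [[_ zzc zzf _] zzl zzr]] := arc_concat za za _ zT; rewrite ?zT//.
  by move=> ji; apply: ij.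
pose x t := z (t - T * (Num.floor (t / T))%:~R).
have xE (n : int) t : T * n%:~R <= t < T * (n + 1)%:~R -> x t = z (t - T * n%:~R).
  move=> /andP[nt tn]; rewrite /x (@floor_def _ _ n)//.
  by rewrite ler_pdivlMr// ltr_pdivrMr// mulrC nt mulrC.
have loc t : exists c : R, T <= t - c < T + T /\
    forall s, t - T < s < t + (T + T - (t - c)) -> zz (s - c) = x s.
  pose n := Num.floor (t / T).
  have := floor_itv (t / T); rewrite -/n ler_pdivlMr// ltr_pdivrMr// => /andP[nt tn].
  have n1 : (n + 1)%:~R = n%:~R + 1 :> R by rewrite intrD.
  rewrite n1 mulrDl mul1r in tn.
  (* This shift puts [t] in the second copy, [[T, 2 T)], so that it is never an end of [zz]. *)
  exists (T * (n - 1)%:~R); rewrite intrB mulrBr mulr1.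
  split; first by apply/andP; split; lra.
  move=> s /andP[s1 s2]; have [sT|Ts] := leP (s - (T * n%:~R - T)) T.
    move: sT; rewrite le_eqVlt => /predU1P[sT|sT].
      rewrite zzr; last by rewrite sT.
      rewrite (xE n); first by congr z; lra.
      by rewrite n1 mulrDr mulr1; apply/andP; split; lra.
    rewrite zzl ?ltW//.
    rewrite (xE (n - 1)); first by congr z; rewrite intrB; lra.
    by rewrite subrK intrB; apply/andP; split; lra.
  rewrite zzr ?ltW// (xE n); first by congr z; lra.
  by rewrite n1 mulrDr mulr1; apply/andP; split; lra.
exists x; split; last first.
  move=> t /andP[t0 tT]; have := xE 0 t.
  by rewrite add0r mulr0z mulr1z mulr0 mulr1 subr0 t0 tT; apply.
split; last first.
  exists T; split=> // t; pose n := Num.floor (t / T).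
  have := floor_itv (t / T); rewrite -/n ler_pdivlMr// ltr_pdivrMr// => /andP[nt tn].
  have n1 (k : int) : (k + 1)%:~R = k%:~R + 1 :> R by rewrite intrD.
  rewrite !n1 mulrDl mul1r in tn.
  rewrite (xE (n + 1)) ?(xE n) ?n1.
  - by congr z; ring.
  - by apply/andP; split; lra.
  - by apply/andP; split; lra.
apply: flows_switched.
  move=> t; have [c [/andP[c1 c2] zzE]] := loc t.
  have zzct : {for t, continuous (fun s => zz (s - c))}.
    apply: continuous_comp; last exact: zzc.
    by apply: cvgB; [exact: cvg_id|exact: cvg_cst].
  rewrite /continuous_at -(zzE t) /=; last by apply/andP; split; lra.
  apply: cvg_trans zzct; apply: near_eq_cvg; near=> s.
  apply: zzE; apply/andP; split; near: s.
    by apply: lt_nbhsr; lra.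
  by apply: lt_nbhsl; lra.
move=> t; have [c [/andP[c1 c2] zzE]] := loc t.
apply: (@flows_at_eq _ _ (fun s => zz (s - c)) _ _ (T + T - (t - c))).
- by lra.
- move=> s /andP[? ?]; apply: zzE; apply/andP; split; lra.
- by apply/flows_at_translate/zzf; apply/andP; split; lra.
Unshelve. all: by end_near. Qed.

(** * The return map *)

Lemma lip_expR (R : realType) (T : Type) (r0 d0 : R) (f : T -> R -> R -> R) :
  lip r0 d0 f -> lip r0 d0 (fun t r l => expR (f t r l)).
Proof.
move=> [C C0 fC]; exists (expR C * (1 + C)) => [|t r l r' l' h1 h2 h3 h4].
  by rewrite mulr_ge0 ?expR_ge0// addr_ge0.
have [f1 f2] := fC t _ _ _ _ h1 h2 h3 h4; have [f3 _] := fC t _ _ _ _ h3 h4 h1 h2.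
have fle := le_trans (ler_norm _) f1; have fle' := le_trans (ler_norm _) f3.
split.
  rewrite ger0_norm ?expR_ge0// (@le_trans _ _ (expR C)) ?ler_expR//.
  by rewrite ler_peMr ?expR_ge0// lerDl.
move: fle fle' f2; move: (f t r l) (f t r' l') => x y xC yC xy.
apply: (@le_trans _ _ (expR C * `|x - y|)); last first.
  rewrite -mulrA ler_wpM2l ?expR_ge0// (le_trans xy)// ler_wpM2r ?addr_ge0//.
  by rewrite lerDr.
wlog yx : x y xC yC {xy} / y <= x => [wl|].
  have [/wl|/ltW/wl] := leP y x; first exact.
  by rewrite distrC (distrC x); exact.
rewrite (ger0_norm (_ : 0 <= x - y)) ?subr_ge0//.
apply: (@mvt_bound _ _ expR) => //.
  exact/continuous_subspaceT/continuous_expR.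
by move=> z /andP[_ zx]; rewrite ger0_norm ?expR_ge0// ler_expR ltW// (lt_le_trans zx).
Qed.

Lemma slip_id (R : realType) (T : Type) (r0 d0 : R) :
  slip r0 d0 (fun (_ : T) (r _ : R) => r).
Proof.
exists 1 => // t r l r' l' /andP[? _] _ /andP[? _] _; split=> //.
by rewrite mul1r lerDl mulr_ge0 ?addr_ge0.
Qed.

(** The substituted radius [p] is itself [O(r)], so the factor [p + p'] produced by [f] is at most a
    multiple of [r + r']. *)
Lemma slip_comp (R : realType) (T : Type) (r0 r1 d0 : R) (f p : T -> R -> R -> R) :
  slip r1 d0 f -> slip r0 d0 p ->
  (forall t r l, 0 <= r <= r0 -> `|l| <= d0 -> 0 <= p t r l <= r1) ->
  slip r0 d0 (fun t r l => f t (p t r l) l).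
Proof.
move=> [C C0 fC] ps pr; have [E E0 pE] := slip_ler ps; case: ps => D D0 pD.
exists (C * (D + E)); first by rewrite mulr_ge0 ?addr_ge0.
move=> t r l r' l' h1 h2 h3 h4; have [p0 pp] := pD t _ _ _ _ h1 h2 h3 h4.
have [f0 ff] := fC t _ _ _ _ (pr t _ _ h1 h2) h2 (pr t _ _ h3 h4) h4.
split; first by rewrite p0.
apply: (le_trans ff); rewrite -mulrA ler_wpM2l// [leRHS]mulrDl lerD//.
have /andP[r_ge0 _] := h1; have /andP[r'_ge0 _] := h3.
apply: (@le_trans _ _ (E * (r + r') * `|l - l'|)).
  rewrite ler_wpM2r// mulrDr lerD// (le_trans (ler_norm _))//; exact: pE.
by rewrite -mulrA ler_wpM2l// lerDr.
Qed.

(** The radius after the first passage is [r] times a Lipschitz factor, hence of class [slip], and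
    may be substituted in [e2]; [r0] keeps it in the domain of [e2]. *)
Lemma exponent_comp (R : realType) (r1 r2 d0 : R) (D : R -> R) (e1 e2 : R -> R -> R) :
  0 < r1 -> 0 < r2 -> lip1 d0 D ->
  slip r1 d0 (fun _ : unit => e1) -> slip r2 d0 (fun _ : unit => e2) ->
  exists r0 : R, [/\ 0 < r0, r0 <= r1,
    forall r l, 0 <= r <= r0 -> `|l| <= d0 -> r * expR (D l + e1 r l) <= r2 &
    slip r0 d0 (fun (_ : unit) r l => e1 r l + e2 (r * expR (D l + e1 r l)) l)].
Proof.
move=> r10 r20 Dl e1s e2s.
have ps : slip r1 d0 (fun (_ : unit) r l => expR (D l + e1 r l) * r).
  apply: slipM (slip_id _ _ _); apply: lip_expR; apply: lipD; last exact: slip_lip.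
  exact: lip_param.
have [C C0 pC] := slip_ler ps.
pose r0 := Num.min r1 (r2 / (C + 1)).
have C1 : 0 < C + 1 by rewrite ltr_wpDl.
have r01 : r0 <= r1 by rewrite /r0 ge_min lexx.
have pr r l : 0 <= r <= r0 -> `|l| <= d0 -> r * expR (D l + e1 r l) <= r2.
  move=> /andP[r_ge0 rr0] ld; rewrite mulrC (le_trans (ler_norm _))//.
  apply: le_trans (pC tt _ _ _ ld) _; first by rewrite r_ge0 (le_trans rr0).
  have : r <= r2 / (C + 1) by rewrite (le_trans rr0)// /r0 ge_min lexx orbT.
  by rewrite ler_pdivlMr//; lra.
exists r0; split=> //; first by rewrite /r0 lt_min r10 divr_gt0.
apply: slipD; first exact: slipW e1s.
apply: (slip_comp (p := fun _ r l => r * expR (D l + e1 r l)) e2s).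
  have [E E0 pE] := slipW r01 (lexx d0) ps; exists E => // t r l r' l' h1 h2 h3 h4.
  by have := pE t r l r' l' h1 h2 h3 h4; rewrite !(mulrC (expR _)).
move=> _ r l rr0 ld; rewrite pr// andbT mulr_ge0 ?expR_ge0//.
by have /andP[] := rr0.
Qed.

(** For fixed [r] the slopes of [E r] lie between half of [d] and three halves of it, so [E r] has
    opposite signs at [- d0] and [d0] once [K * r <= |d| / 2 * d0]. Two zeros satisfy [|d| * |l -
    l'| <= |d| / 2 * |l - l'| + K * |r - r'|], which gives uniqueness and the constant [2 * K / |d|]
    together. *)
Lemma implicit_parameter (R : realType) (E : R -> R -> R) (r0 d0 d K : R) :
  0 < r0 -> 0 < d0 -> d != 0 -> 0 <= K -> E 0 0 = 0 ->
  (forall r l r' l', 0 <= r <= r0 -> `|l| <= d0 -> 0 <= r' <= r0 -> `|l'| <= d0 ->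
     `|E r l - E r' l' - d * (l - l')| <= `|d| / 2 * `|l - l'| + K * `|r - r'|) ->
  exists (r1 L : R) (lam : R -> R), [/\ 0 < r1 <= r0, lam 0 = 0,
    forall r, 0 <= r <= r1 -> `|lam r| <= d0 /\ E r (lam r) = 0 &
    forall r r', 0 <= r <= r1 -> 0 <= r' <= r1 ->
      `|lam r - lam r'| <= L * `|r - r'|].
Proof.
move=> r00 d00 dn0 K0 E00 EH.
have nd0 : 0 < `|d| by rewrite normr_gt0.
have K1 : 0 < K + 1 by rewrite ltr_wpDl.
pose r1 := Num.min r0 (`|d| / 2 * d0 / (K + 1)).
have r10 : 0 < r1 by rewrite /r1 lt_min r00 !(divr_gt0, mulr_gt0).
have r1r0 : r1 <= r0 by rewrite /r1 ge_min lexx.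
have Kr1 : K * r1 <= `|d| / 2 * d0.
  have : r1 <= `|d| / 2 * d0 / (K + 1) by rewrite /r1 ge_min lexx orbT.
  by rewrite ler_pdivlMr//; have := ltW r10; lra.
have zr0 : (0 : R) <= (0 : R) <= r0 by rewrite lexx ltW.
have zd0 : `|0 : R| <= d0 by rewrite normr0 ltW.
have sol r : 0 <= r <= r1 -> exists l, `|l| <= d0 /\ E r l = 0.
  move=> /andP[r_ge0 rr1].
  have rr0 : 0 <= r <= r0 by rewrite r_ge0 (le_trans rr1).
  have Nd : - d0 <= d0 by lra.
  pose F l := E r (clamp (- d0) d0 l).
  have cl l : `|clamp (- d0) d0 l| <= d0 by rewrite ler_norml clamp_itv.
  have Fc : continuous F.
    apply: (@lipschitz_cts _ _ (`|d| / 2 + `|d|)) => x y.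
    have := EH r _ r _ rr0 (cl x) rr0 (cl y).
    rewrite subrr normr0 mulr0 addr0 -/(F x) -/(F y).
    have := clamp_lip (- d0) d0 x y.
    set s := clamp _ _ x - clamp _ _ y => sxy H.
    rewrite -(subrK (d * s) (F x - F y)) (le_trans (ler_normD _ _))//.
    rewrite mulrDl lerD// ?normrM ?ler_wpM2l//.
    by rewrite (le_trans H)// ler_wpM2l// divr_ge0.
  have Kr : K * r <= `|d| / 2 * d0 by rewrite (le_trans _ Kr1)// ler_wpM2l.
  have nd : `|d0| = d0 by rewrite gtr0_norm.
  have d0d : `|d0| <= d0 by rewrite nd.
  have d0d' : `|- d0| <= d0 by rewrite normrN nd.
  have Ep := EH r d0 0 0 rr0 d0d zr0 zd0.
  have En := EH r (- d0) 0 0 rr0 d0d' zr0 zd0.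
  rewrite E00 !subr0 nd (ger0_norm r_ge0) in Ep.
  rewrite E00 !subr0 normrN nd (ger0_norm r_ge0) in En.
  have cp : clamp (- d0) d0 d0 = d0 by rewrite clamp_id// Nd lexx.
  have cn : clamp (- d0) d0 (- d0) = - d0 by rewrite clamp_id// Nd lexx.
  have [|l _ Fl] := @IVT R F (- d0) d0 0 Nd (continuous_subspaceT Fc).
    rewrite /F cp cn ge_min le_max.
    move: Ep En; rewrite !ler_norml => /andP[p1 p2] /andP[q1 q2].
    move: dn0; rewrite neq_lt => /orP[dneg|dpos].
      rewrite ltr0_norm// in Kr p1 p2 q1 q2.
      by apply/andP; split; apply/orP; [right|left]; lra.
    rewrite gtr0_norm// in Kr p1 p2 q1 q2.
    by apply/andP; split; apply/orP; [left|right]; lra.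
  by exists (clamp (- d0) d0 l).
have /choice[lam lamP] : forall r, exists l, 0 <= r <= r1 -> `|l| <= d0 /\ E r l = 0.
  move=> r; have [/sol[l lP]|nr] := boolP (0 <= r <= r1); first by exists l.
  by exists 0.
have lip_root r l r' l' : 0 <= r <= r1 -> `|l| <= d0 -> 0 <= r' <= r1 -> `|l'| <= d0 ->
    E r l = 0 -> E r' l' = 0 -> `|l - l'| <= 2 * K / `|d| * `|r - r'|.
  move=> /andP[r_ge0 rr] ld /andP[r'_ge0 rr'] l'd El El'.
  have rr0 : 0 <= r <= r0 by rewrite r_ge0 (le_trans rr).
  have rr0' : 0 <= r' <= r0 by rewrite r'_ge0 (le_trans rr').
  have := EH r l r' l' rr0 ld rr0' l'd.
  rewrite El El' subrr sub0r normrN normrM => H.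
  by rewrite mulrAC ler_pdivlMr//; lra.
have z1 : (0 : R) <= (0 : R) <= r1 by rewrite lexx ltW.
exists r1, (2 * K / `|d|), lam; split=> //.
- by rewrite r10.
- have [l0 El0] := lamP 0 z1.
  have := lip_root 0 (lam 0) 0 0 z1 l0 z1 zd0 El0 E00.
  by rewrite !subr0 normr0 mulr0 normr_le0 => /eqP.
- move=> r r' h h'; have [? ?] := lamP r h; have [? ?] := lamP r' h'.
  exact: lip_root.
Qed.

(** * Rotations carrying the fourth quadrant onto the others *)

Definition rot (R : realType) (q : quadrant) (u v : R) : 'cV[R]_2 :=
  match q with
  | Q4 => col2 u v
  | Q3 => col2 v (- u)
  | Q2 => col2 (- u) (- v)
  | Q1 => col2 (- v) u
  end.

(** Orbits turn clockwise: at [(u, 0)] with [u > 0] the linear field points into the fourth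
    quadrant. *)
Definition nxt (q : quadrant) : quadrant :=
  match q with Q4 => Q3 | Q3 => Q2 | Q2 => Q1 | Q1 => Q4 end.

Lemma rot_nxt (R : realType) (q : quadrant) (s : R) : rot q 0 (- s) = rot (nxt q) s 0.
Proof. by case: q => /=; rewrite ?oppr0 ?opprK. Qed.

Lemma region_rot (R : realType) (q : quadrant) (u v : R) :
  0 < u -> v < 0 -> region q (rot q u v).
Proof. by case: q => /= u0 v0; rewrite col2E0 col2E1; split; lra. Qed.

(** The half axis by which a quadrant is entered belongs to the region visited before. *)
Lemma region_rot_axis (R : realType) (q : quadrant) (u : R) :
  region q (rot q u 0) -> False.
Proof. by case: q => /=; rewrite col2E0 col2E1 => -[? ?]; lra. Qed.

Lemma rot_neq0 (R : realType) (q : quadrant) (u v : R) :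
  (u != 0) || (v != 0) -> rot q u v != 0.
Proof.
move=> uv; apply/eqP => e.
have e0 : rot q u v 0 0 = 0 by rewrite e mxE.
have e1 : rot q u v 1 0 = 0 by rewrite e mxE.
have [u0 v0] : u = 0 /\ v = 0.
  by move: e0 e1; case: (q) => /=; rewrite col2E0 col2E1; split; lra.
by rewrite u0 v0 eqxx in uv.
Qed.

Lemma col2B (R : realType) (u v u' v' : R) :
  col2 u v - col2 u' v' = col2 (u - u') (v - v').
Proof. by apply/matrixP => i j; rewrite !mxE; case: ifP. Qed.

Lemma continuous_col2 (R : realType) (f g : R -> R) :
  continuous f -> continuous g -> continuous (fun t => col2 (f t) (g t)).
Proof.
move=> fc gc t; apply/cvgrPdist_le => e e0; near=> s.
rewrite col2B; apply: ler_norm_col2; near: s.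
  by move/cvgrPdist_le : (fc t); apply.
by move/cvgrPdist_le : (gc t); apply.
Unshelve. all: by end_near. Qed.

Lemma is_derive_col2 (R : realType) (f g : R -> R) (t df dg : R) :
  is_derive t 1 f df -> is_derive t 1 g dg ->
  is_derive t 1 (fun s => col2 (f s) (g s)) (col2 df dg).
Proof.
move=> [fd fD] [gd gD].
have E i j : (fun s => col2 (f s) (g s) i j) = if i == 0 then f else g.
  by apply/funext => s; rewrite mxE; case: ifP.
have M : derivable (fun s => col2 (f s) (g s)) t 1.
  apply/derivable_mxP => i j; rewrite E.
  by case: ifP => _; [exact: fd|exact: gd].
split=> //; rewrite derive_mx//; apply/matrixP => i j; rewrite !mxE E.
by case: ifP.
Qed.

Lemma continuous_rot (R : realType) (q : quadrant) (f g : R -> R) :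
  continuous f -> continuous g -> continuous (fun t => rot q (f t) (g t)).
Proof.
move=> fc gc.
have fNc : continuous (fun t => - f t) by move=> t; apply: cvgN; exact: fc.
have gNc : continuous (fun t => - g t) by move=> t; apply: cvgN; exact: gc.
by case: q; exact: continuous_col2.
Qed.

Lemma is_derive_rot (R : realType) (q : quadrant) (f g : R -> R) (t df dg : R) :
  is_derive t 1 f df -> is_derive t 1 g dg ->
  is_derive t 1 (fun s => rot q (f s) (g s)) (rot q df dg).
Proof.
move=> fD gD; case: q; apply: is_derive_col2 => //; exact: is_deriveN.
Qed.

Definition rot_inv0 (R : realType) (q : quadrant) (w : 'cV[R]_2) : R :=
  match q with Q4 => w 0 0 | Q3 => - w 1 0 | Q2 => - w 0 0 | Q1 => w 1 0 end.

Definition rot_inv1 (R : realType) (q : quadrant) (w : 'cV[R]_2) : R :=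
  match q with Q4 => w 1 0 | Q3 => w 0 0 | Q2 => - w 1 0 | Q1 => - w 0 0 end.

Lemma rotK (R : realType) (q : quadrant) (w : 'cV[R]_2) :
  rot q (rot_inv0 q w) (rot_inv1 q w) = w.
Proof. by rewrite [RHS]col2_eta; case: q => /=; rewrite ?opprK. Qed.

Lemma rotD (R : realType) (q : quadrant) (u v u' v' : R) :
  rot q u v + rot q u' v' = rot q (u + u') (v + v').
Proof.
by case: q => /=; apply/matrixP => i j; rewrite !mxE; case: ifP => _;
  rewrite ?opprD.
Qed.

Lemma mx22_col2 (R : realType) (m00 m01 m10 m11 u v : R) :
  mx22 m00 m01 m10 m11 *m col2 u v = col2 (m00 * u + m01 * v) (m10 * u + m11 * v).
Proof.
apply/matrixP => i j; rewrite !mxE big_ord_recl big_ord1 !mxE /=.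
by case: ifP.
Qed.

(** Conjugation by a quarter turn exchanges [b] and [c], which is exactly how the matrices of
    adjacent regions differ. *)
Lemma Amx_rot (R : realType) (a : R) (b c : R -> R) (q : quadrant) (l u v : R) :
  Amx a b c q l *m rot q u v = rot q (- a * u + c l * v) (- b l * u - a * v).
Proof.
by case: q => /=; rewrite mx22_col2; congr col2; ring.
Qed.

Lemma subsystem_rot (R : realType) (a : R) (b c : R -> R)
    (fbar : quadrant -> 'cV[R]_2 -> R -> 'cV[R]_2) (l : R) (q : quadrant) (u v : R) :
  subsystem a b c fbar l q (rot q u v) =
  rot q (- a * u + c l * v + rot_inv0 q (fbar q (rot q u v) l))
        (- b l * u - a * v + rot_inv1 q (fbar q (rot q u v) l)).
Proof. by rewrite /subsystem Amx_rot -[RHS]rotD rotK. Qed.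

Lemma quadraticW (R : realType) (d d' C C' : R) (g : R -> R -> R -> R) :
  d' <= d -> C <= C' -> quadratic d C g -> quadratic d' C' g.
Proof.
move=> dd CC [g0 gC]; split=> [l ld|e u v l u' v' l' ed ue ve ld u'e v'e l'd].
  by rewrite g0// (le_trans ld).
have e0 : 0 <= e := le_trans (normr_ge0 _) ue.
apply: le_trans (gC e _ _ _ _ _ _ _ _ _ _ _ _ _) _ => //; rewrite ?(le_trans _ dd)//.
by rewrite -!mulrA ler_wpM2r// mulr_ge0// !addr_ge0// mulr_ge0.
Qed.

Lemma quadraticN (R : realType) (d C : R) (g : R -> R -> R -> R) :
  quadratic d C g -> quadratic d C (fun u v l => - g u v l).
Proof.
move=> [g0 gC]; split=> [l ld|e u v l u' v' l' ed ue ve ld u'e v'e l'd].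
  by rewrite g0// oppr0.
by rewrite -opprD normrN; exact: gC.
Qed.

Lemma quadratic_rot (R : realType) (d C : R) (q : quadrant) (g : 'cV[R]_2 -> R -> R) :
  quadratic d C (fun u v l => g (col2 u v) l) ->
  quadratic d C (fun u v l => g (rot q u v) l).
Proof.
move=> [g0 gC]; split=> [l ld|e u v l u' v' l' ed ue ve ld u'e v'e l'd].
  by case: q => /=; rewrite ?oppr0; exact: g0.
have N (x y : R) : `|- x - - y| = `|x - y| by rewrite -opprD normrN.
case: q => /=.
- by rewrite (addrC `|u - u'|) -(N v); apply: gC; rewrite ?normrN.
- by rewrite -(N v) -(N u); apply: gC; rewrite ?normrN.
- by rewrite (addrC `|u - u'|) -(N u); apply: gC; rewrite ?normrN.
- exact: gC.
Qed.

(** * Chaining quarter turns into a closed orbit *)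

Section chain.
Variables (R : realType) (a d0 m C : R) (b c : R -> R).
Variable fbar : quadrant -> 'cV[R]_2 -> R -> 'cV[R]_2.
Let om l : R := Num.sqrt (b l * c l).
Let kap l : R := Num.sqrt (b l / c l).
Hypotheses (a0 : 0 < a) (d00 : 0 < d0) (m0 : 0 < m) (C0 : 0 <= C).
Hypothesis b_gt0 : forall l, `|l| <= d0 -> 0 < b l.
Hypothesis c_gt0 : forall l, `|l| <= d0 -> 0 < c l.
Hypothesis om_ge : forall l, `|l| <= d0 -> m <= om l.
Hypothesis kap_ge : forall l, `|l| <= d0 -> m <= kap l.
Hypotheses (om_lip : lip1 d0 om) (kap_lip : lip1 d0 kap).
Hypothesis fbar_quadratic : forall q (i : 'I_2),
  quadratic d0 C (fun u v l => fbar q (col2 u v) l i 0).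

(** Linear orbits spiral across the ellipses [b * u ^ 2 + c * v ^ 2 = const], whose semi-axis ratio
    is [kap]. A quarter turn leads from one axis to the other and lasts [pi / 2 / om], under
    contraction at rate [a]. *)
Definition quarter_exponent (l : R) : R := ln (kap l) - a / om l * (pi / 2).

Let om_kap l : `|l| <= d0 -> om l / kap l = c l /\ kap l * om l = b l.
Proof.
move=> ld; have bl := b_gt0 ld; have cl := c_gt0 ld.
have kap0 : 0 < kap l by apply: lt_le_trans (kap_ge ld).
have omE : om l = kap l * c l.
  rewrite /om /kap -[X in _ = _ * X](ger0_norm (ltW cl)) -sqrtr_sqr.
  rewrite -sqrtrM ?divr_ge0 ?ltW//.
  by congr Num.sqrt; field; rewrite gt_eqF.
split; first by rewrite omE mulrC mulKf// gt_eqF.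
by rewrite omE mulrA -expr2 sqr_sqrtr ?divr_ge0 ?ltW// divfK// gt_eqF.
Qed.

Hypothesis quarter_exponent_lip : lip1 d0 quarter_exponent.

Lemma quarter_arc (q : quadrant) : exists (r1 : R) (e : R -> R -> R),
  [/\ 0 < r1, slip r1 d0 (fun _ : unit => e) & forall r l, 0 < r <= r1 -> `|l| <= d0 ->
  exists (T : R) (z : R -> 'cV[R]_2), [/\ arc (subsystem a b c fbar l) z T q q,
    z 0 = rot q r 0 &
    z T = rot q 0 (- (r * expR (quarter_exponent l + e r l)))]].
Proof.
pose g1 u v l := rot_inv0 q (fbar q (rot q u v) l).
pose g2 u v l := rot_inv1 q (fbar q (rot q u v) l).
have fr i : quadratic d0 C (fun u v l => fbar q (rot q u v) l i 0).
  exact: (@quadratic_rot _ _ _ q (fun x l => fbar q x l i 0) (fbar_quadratic q i)).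
have g1q : quadratic d0 C g1.
  rewrite /g1; case: (q) fr => fr; rewrite /rot_inv0 => //; exact: quadraticN.
have g2q : quadratic d0 C g2.
  rewrite /g2; case: (q) fr => fr; rewrite /rot_inv1 => //; exact: quadraticN.
have [r1 [e [r10 es H]]] :=
  quarter_map a0 d00 m0 C0 om_ge kap_ge om_lip kap_lip g1q g2q.
exists r1, e; split=> // r l rr1 ld.
have [T [y1 [y2 [T0 y1c y2c [y10 y20 y1T y2T] yd]]]] := H r l rr1 ld.
have [omkap kapom] := om_kap ld.
exists T, (fun t => rot q (y1 t) (y2 t)); split.
- split=> //; first exact: continuous_rot.
  + move=> t /andP[t0 tT]; have [y1t y2t D1 D2] := yd t (introT andP (conj t0 tT)).
    split; first by rewrite rot_neq0// gt_eqF.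
    exists (Num.min t (T - t)), q, q; split.
    * by rewrite lt_min t0 subr_gt0.
    * move=> s /andP[]; rewrite ltrBlDr -ltrBlDl lt_min => /andP[? ?] ?.
      by have [] := yd s; [apply/andP; split; lra|move=> *; exact: region_rot].
    * move=> s /andP[?]; rewrite -ltrBlDl lt_min => /andP[? ?].
      by have [] := yd s; [apply/andP; split; lra|move=> *; exact: region_rot].
    * move=> _; split; first exact: region_rot.
      rewrite subsystem_rot; apply: is_derive_rot.
        by rewrite -omkap.
      by rewrite -kapom.
  + by exists T => //; split=> s /andP[? ?];
      (have [] := yd s; [apply/andP; split; lra|move=> *; exact: region_rot]).
- by rewrite y10 y20.
- by rewrite y1T y2T.
Qed.

(** The induction peels off the first quarter turn: exponents compose by [exponent_comp], and by
    [rot_nxt] the exit point of one quadrant is the entry point of the next. *)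
Lemma arc_chain (n : nat) (q : quadrant) : exists (r1 : R) (e : R -> R -> R),
  [/\ 0 < r1, slip r1 d0 (fun _ : unit => e) & forall r l, 0 < r <= r1 -> `|l| <= d0 ->
  exists (T : R) (z : R -> 'cV[R]_2), [/\
    arc (subsystem a b c fbar l) z T q (iter n nxt q),
    z 0 = rot q r 0 &
    z T = rot (iter n nxt q) 0
      (- (r * expR (n.+1%:R * quarter_exponent l + e r l)))]].
Proof.
elim: n q => [|n IH] q.
  have [r1 [e [r10 es H]]] := quarter_arc q; exists r1, e; split=> // r l rr1 ld.
  by have [T [z zP]] := H r l rr1 ld; exists T, z; rewrite mul1r.
have [r1 [e1 [r10 e1s H1]]] := quarter_arc q.
have [r2 [e2 [r20 e2s H2]]] := IH (nxt q).
have [r0 [r00 r01 r02 es]] := exponent_comp r10 r20 quarter_exponent_lip e1s e2s.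
eexists r0, _; split; [exact: r00|exact: es|].
move=> r l /andP[r_gt0 rr0] ld.
have [|T1 [z1 [z1a z10 z1T]]] := H1 r l _ ld; first by rewrite r_gt0 (le_trans rr0).
pose s := r * expR (quarter_exponent l + e1 r l).
have s0 : 0 < s by rewrite mulr_gt0 ?expR_gt0.
have [|T2 [z2 [z2a z20 z2T]]] := H2 s l _ ld.
  by rewrite s0 r02// rr0 ltW.
have [| | |z [za zl zr]] := arc_concat z1a z2a.
- by case: (q).
- by rewrite z1T z20 rot_nxt.
- by rewrite z1T -/s rot_neq0// oppr_eq0 (gt_eqF s0) orbT.
have [T10 _ _ _] := z1a; have [T20 _ _ _] := z2a.
exists (T1 + T2), z; rewrite iterSr; split=> //.
  by rewrite zl// ltW.
rewrite zr ?lerDl ?ltW// addrC addKr z2T; congr (rot _ _ (- _)).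
rewrite /s -mulrA -expRD -[n.+2%:R]natr1; congr (_ * expR _); ring.
Qed.

Lemma periodic_branch (d : R) (q : quadrant) : d != 0 -> quarter_exponent 0 = 0 ->
  (forall l l', `|l| <= d0 -> `|l'| <= d0 ->
    `|4 * quarter_exponent l - 4 * quarter_exponent l' - d * (l - l')| <=
    `|d| / 4 * `|l - l'|) ->
  exists (r1 L : R) (lam : R -> R), [/\ 0 < r1, lam 0 = 0,
    forall r, 0 <= r <= r1 -> `|lam r| <= d0,
    forall r r', 0 <= r <= r1 -> 0 <= r' <= r1 ->
      `|lam r - lam r'| <= L * `|r - r'| &
    forall r, 0 < r <= r1 -> exists x : R -> 'cV[R]_2, [/\
      periodic_solution (subsystem a b c fbar (lam r)) x,
      x 0 = rot q r 0 & exists t, x t <> x 0]].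
Proof.
move=> dn0 D0 strict.
have [r1 [e [r10 [K K0 eK] H]]] := arc_chain 3 q.
have nd0 : 0 < `|d| by rewrite normr_gt0.
have K1 : 0 < K + 1 by rewrite ltr_wpDl.
(* For radii up to [r2] the error [e] contributes at most [|d| / 4] to the Lipschitz constant in
   [l], and [strict] another [|d| / 4]; [implicit_parameter] allows their sum. *)
pose r2 := Num.min r1 (`|d| / 8 / (K + 1)).
have r20 : 0 < r2 by rewrite /r2 lt_min r10 !divr_gt0.
have r2r1 : r2 <= r1 by rewrite /r2 ge_min lexx.
have r2K : K * r2 <= `|d| / 8.
  have : r2 <= `|d| / 8 / (K + 1) by rewrite /r2 ge_min lexx orbT.
  by rewrite ler_pdivlMr//; have := ltW r20; lra.
pose E r l := 4 * quarter_exponent l + e r l.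
have z0 : (0 : R) <= (0 : R) <= r1 by rewrite lexx ltW.
have zd : `|0 : R| <= d0 by rewrite normr0 ltW.
have E0 : E 0 0 = 0.
  by have [e0 _] := eK tt 0 0 0 0 z0 zd z0 zd; rewrite /E D0 e0 mulr0 addr0.
have [r l r' l' /andP[r_ge0 rr] ld /andP[r'_ge0 rr'] l'd|] :=
  @implicit_parameter _ E r2 d0 d K r20 d00 dn0 K0 E0.
  have rr1 : 0 <= r <= r1 by rewrite r_ge0 (le_trans rr).
  have rr1' : 0 <= r' <= r1 by rewrite r'_ge0 (le_trans rr').
  have [_ ee] := eK tt _ _ _ _ rr1 ld rr1' l'd.
  have := strict l l' ld l'd.
  have Krr : K * ((r + r') * `|l - l'|) <= `|d| / 4 * `|l - l'|.
    rewrite mulrA ler_wpM2r//.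
    have : K * r <= K * r2 by rewrite ler_wpM2l.
    have : K * r' <= K * r2 by rewrite ler_wpM2l.
    lra.
  rewrite (_ : E r l - E r' l' - d * (l - l') =
    (4 * quarter_exponent l - 4 * quarter_exponent l' - d * (l - l')) +
    (e r l - e r' l')); last by rewrite /E; ring.
  move=> S; apply: le_trans (ler_normD _ _) _.
  by move: S ee; lra.
move=> r3 [L [lam [/andP[r30 r3r2] lam0 lamP lamL]]].
exists r3, L, lam; split=> //; first by move=> r /lamP[].
move=> r /andP[r_gt0 rr3].
have [|lamd El] := lamP r; first by rewrite ltW.
have [|T [z [za z0E zTE]]] := H r (lam r) _ lamd.
  by rewrite r_gt0 (le_trans rr3)// (le_trans r3r2).
rewrite -/(E r (lam r)) El expR0 mulr1 rot_nxt in zTE.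
have q4 : nxt (iter 3 nxt q) = q by case: (q).
rewrite q4 -z0E in zTE.
have [||x [xp xz]] := arc_periodic za _ zTE.
- by case: (q).
- by rewrite z0E rot_neq0// gt_eqF.
have [T0 _ _ [e' e'0 [zq _]]] := za.
have x0 : x 0 = z 0 by apply: xz; rewrite lexx.
exists x; split=> //; first by rewrite x0.
(* Shortly after time [0] the orbit is inside region [q], which does not contain its starting point;
   hence it is not constant. *)
pose s := Num.min e' T / 2.
have m0' : 0 < Num.min e' T by rewrite lt_min e'0.
have s0 : 0 < s by rewrite divr_gt0.
have [se sT] : s < e' /\ s < T.
  have : s < Num.min e' T by rewrite /s; lra.
  by rewrite lt_min => /andP[].
exists s; rewrite x0 xz; last by rewrite ltW.
move=> zs; have := zq s; rewrite s0 se => /(_ isT).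
by rewrite zs z0E => /region_rot_axis.
Qed.

End chain.

(** * Strict differentiability of Delta *)

(** The derivative exists around [x] but is continuous only at [x]: enough for strict
    differentiability there, and easily propagated through sums, products and compositions. *)
Definition c1_at (R : realType) (f : R -> R) (x : R) : Prop :=
  exists df : R -> R,
    (\forall y \near x, is_derive (y : R) 1 f (df y)) /\ {for x, continuous df}.

Lemma c1_at_continuous (R : realType) (f : R -> R) (x : R) :
  c1_at f x -> {for x, continuous f}.
Proof. by move=> [df [/nbhs_singleton /is_derive_continuous]]. Qed.

Lemma c1_at_derive (R : realType) (f : R -> R) (x : R) :
  c1_at f x -> is_derive x 1 f (derive1 f x).
Proof.
move=> [df [/nbhs_singleton fd _]]; rewrite derive1E.
by apply: DeriveDef => //; case: fd.
Qed.

Lemma c1_at_cst (R : realType) (k x : R) : c1_at (fun=> k) x.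
Proof.
exists (fun=> 0); split; last exact: cvg_cst.
by near=> y; exact: is_derive_cst.
Unshelve. all: by end_near. Qed.

Lemma c1_atD (R : realType) (f g : R -> R) (x : R) :
  c1_at f x -> c1_at g x -> c1_at (fun y => f y + g y) x.
Proof.
move=> [df [fd fc]] [dg [gd gc]]; exists (fun y => df y + dg y); split.
  by near=> y; apply: is_deriveD; near: y.
exact: cvgD.
Unshelve. all: by end_near. Qed.

Lemma c1_atM (R : realType) (f g : R -> R) (x : R) :
  c1_at f x -> c1_at g x -> c1_at (fun y => f y * g y) x.
Proof.
move=> f1 g1; have fx := c1_at_continuous f1; have gx := c1_at_continuous g1.
move: f1 g1 => [df [fd fc]] [dg [gd gc]].
exists (fun y => f y * dg y + g y * df y); split.
  by near=> y; apply: is_deriveM; near: y.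
by apply: cvgD; apply: cvgM.
Unshelve. all: by end_near. Qed.

Lemma c1_at_comp (R : realType) (f g : R -> R) (x : R) :
  c1_at f x -> c1_at g (f x) -> c1_at (fun y => g (f y)) x.
Proof.
move=> f1; have fx := c1_at_continuous f1.
move: f1 => [df [fd fc]] [dg [gd gc]].
exists (fun y => dg (f y) * df y); split.
  near=> y; apply: (@is_derive1_comp _ g f); near: y => //.
  exact: (fx _ gd).
apply: cvgM; last exact: fc.
exact: continuous_comp.
Unshelve. all: by end_near. Qed.

Lemma c1_at_inv (R : realType) (x : R) : 0 < x -> c1_at (fun y : R => y^-1) x.
Proof.
move=> x0; exists (fun y => - y ^- 2); split.
  near=> y; have y0 : y != 0 by rewrite gt_eqF//; near: y; exact: lt_nbhsr.
  by have := is_deriveV y0 (@is_derive_id _ R y 1); rewrite [_ *: 1]mulr1.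
apply: cvgN; apply: cvgV; first by rewrite expf_neq0// gt_eqF.
exact: exprn_continuous.
Unshelve. all: by end_near. Qed.

Lemma c1_at_ln (R : realType) (x : R) : 0 < x -> c1_at (@ln R) x.
Proof.
move=> x0; exists (fun y => y^-1); split.
  by near=> y; apply: is_derive1_ln; near: y; exact: lt_nbhsr.
by apply: inv_continuous; rewrite gt_eqF.
Unshelve. all: by end_near. Qed.

Lemma c1_at_sqrt (R : realType) (x : R) : 0 < x -> c1_at (@Num.sqrt R) x.
Proof.
move=> x0; exists (fun y => (2 * Num.sqrt y)^-1); split.
  by near=> y; apply: is_derive1_sqrt; near: y; exact: lt_nbhsr.
apply: cvgV; first by rewrite mulf_neq0// gt_eqF// sqrtr_gt0.
by apply: cvgM; [exact: cvg_cst|exact: sqrt_continuous].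
Unshelve. all: by end_near. Qed.

Lemma c1_at_smooth (R : realType) (I : set R) (f : R -> R) (x : R) :
  open I -> I x -> smooth_on I f -> c1_at f x.
Proof.
move=> Io Ix fs; exists (derive1 f); split.
  near=> y; rewrite derive1E; apply: derivableP.
  by apply: (fs 0%N); near: y; exact: open_nbhs_nbhs.
by apply/differentiable_continuous/derivable1_diffP; exact: (fs 1%N).
Unshelve. all: by end_near. Qed.

(** The mean value bound is applied to [f s - df x * s], whose derivative [df s - df x] is small
    near [x]. *)
Lemma c1_at_strict (R : realType) (f : R -> R) (x e : R) : c1_at f x -> 0 < e ->
  exists2 d, 0 < d & forall y z, `|y - x| <= d -> `|z - x| <= d ->
    `|f y - f z - derive1 f x * (y - z)| <= e * `|y - z|.
Proof.
move=> f1 e0; have [_ fxE] := c1_at_derive f1; move: f1 => [df [fd fc]].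
have dfx : derive1 f x = df x.
  by rewrite derive1E; have [_ <-] := nbhs_singleton fd.
rewrite dfx.
have : \forall y \near x, is_derive (y : R) 1 f (df y) /\ `|df x - df y| <= e.
  by near=> y; split; near: y => //; move/cvgrPdist_le : fc; apply.
move=> /nbhs_normP[r /= r0 rP]; exists (r / 2); first by rewrite divr_gt0.
have key (y z : R) : z <= y -> `|y - x| <= r / 2 -> `|z - x| <= r / 2 ->
    `|f y - f z - df x * (y - z)| <= e * `|y - z|.
  move=> zy yx zx.
  have dP (s : R) : z <= s <= y -> is_derive s 1 f (df s) /\ `|df x - df s| <= e.
    move=> /andP[zs sy]; apply: rP => /=; rewrite distrC ltr_norml.
    by move: yx zx; rewrite !ler_norml => /andP[? ?] /andP[? ?]; apply/andP; split; lra.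
  pose h (s : R) := f s - df x * s.
  have hD (s : R) : z <= s <= y -> is_derive s 1 h (df s - df x).
    move=> /dP[sD _]; apply: is_deriveB.
    by have := is_deriveZ (df x) (@is_derive_id _ R s 1); rewrite [_ *: 1]mulr1.
  rewrite (ger0_norm (_ : 0 <= y - z)) ?subr_ge0//.
  rewrite (_ : f y - f z - df x * (y - z) = h y - h z); last by rewrite /h; ring.
  apply: (@mvt_bound _ _ (fun s => df s - df x)) => //.
  - apply: derivable_within_continuous => s; rewrite in_itv/= => /hD.
    by case.
  - by move=> s /andP[/ltW ? /ltW ?]; apply: hD; apply/andP.
  - move=> s /andP[/ltW ? /ltW ?]; rewrite distrC.
    by have [] := dP s; [apply/andP|].
move=> y z yx zx; have [zy|/ltW yz] := leP z y; first exact: key.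
rewrite (_ : _ - _ - _ = - (f z - f y - df x * (z - y))); last by ring.
by rewrite normrN (distrC y); exact: key.
Unshelve. all: by end_near. Qed.

Lemma c1_at_lip1 (R : realType) (f : R -> R) : c1_at f 0 ->
  exists2 d, 0 < d & lip1 d f.
Proof.
move=> f1; have [d d0 dP] := c1_at_strict f1 ltr01; exists d => //.
pose L := 1 + `|derive1 f 0|; have L0 : 0 <= L by rewrite addr_ge0.
have fL y z : `|y| <= d -> `|z| <= d -> `|f y - f z| <= L * `|y - z|.
  move=> yd zd; have := dP y z; rewrite !subr0 => /(_ yd zd) H.
  rewrite -(subrK (derive1 f 0 * (y - z)) (f y - f z)) (le_trans (ler_normD _ _))//.
  by rewrite mulrDl lerD// normrM.
have z0 : `|0 : R| <= d by rewrite normr0 ltW.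
exists (L + `|f 0| + L * d) => [|t r l r' l' _ ld _ l'd].
  by rewrite !addr_ge0// mulr_ge0// ltW.
have Ld : 0 <= L * d by rewrite mulr_ge0// ltW.
split.
  have := fL l 0 ld z0; rewrite subr0 => H.
  rewrite -(subrK (f 0) (f l)) (le_trans (ler_normD _ _))//.
  have : L * `|l| <= L * d by rewrite ler_wpM2l.
  lra.
apply: (le_trans (fL _ _ ld l'd)); apply: ler_pM => //; last by rewrite lerDr.
by rewrite -addrA lerDl addr_ge0.
Qed.

Lemma c1_at_ge (R : realType) (f : R -> R) : c1_at f 0 -> 0 < f 0 ->
  exists2 d, 0 < d & forall l, `|l| <= d -> f 0 / 2 <= f l.
Proof.
move=> /c1_at_continuous fc f0.
have : \forall y \near (0 : R), f 0 / 2 <= f y.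
  by near=> y; apply: ltW; near: y; apply: (cvgr_gt (f 0)) => //; lra.
move=> /nbhs_normP[r /= r0 rP]; exists (r / 2); first by rewrite divr_gt0.
by move=> l ld; apply: rP => /=; rewrite sub0r normrN; lra.
Unshelve. all: by end_near. Qed.

(** * Existence of the branch *)

Lemma common_quadratic (R : realType) (I : set R) (d1 : R)
    (fbar : quadrant -> 'cV[R]_2 -> R -> 'cV[R]_2) :
  0 < d1 -> (forall l, `|l| <= d1 -> I l) ->
  (forall (i : quadrant) (p : 'cV[R]_2) (l : R), I l -> analytic_at (fbar i) p l) ->
  (forall (i : quadrant) (l : R), I l ->
    (fun x : 'cV[R]_2 => fbar i x l) =o_ (nbhs (0 : 'cV[R]_2)) id) ->
  exists d C : R, [/\ 0 < d, 0 <= C & forall q (i : 'I_2),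
    quadratic d C (fun u v l => fbar q (col2 u v) l i 0)].
Proof.
move=> d10 d1I an fo.
have I0 : I 0 by apply: d1I; rewrite normr0 ltW.
have one q i := analytic_quadratic i (an q 0 0 I0) d10 (fun l ld => fo q l (d1I l ld)).
have two q : exists d C : R, [/\ 0 < d, 0 <= C & forall i : 'I_2,
    quadratic d C (fun u v l => fbar q (col2 u v) l i 0)].
  have [d [C [d0 C0 H]]] := one q 0; have [d' [C' [d'0 C'0 H']]] := one q 1.
  exists (Num.min d d'), (Num.max C C'); split; first by rewrite lt_min d0.
    by rewrite le_max C0.
  move=> i; have [->|->] : i = 0 \/ i = 1.
    by case: i => -[|[|]]// ?; [left|right]; exact: val_inj.
  - by apply: quadraticW H; rewrite ?ge_min ?le_max lexx.
  - by apply: quadraticW H'; rewrite ?ge_min ?le_max lexx orbT.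
have [da [Ca [da0 Ca0 Ha]]] := two Q1; have [db [Cb [db0 Cb0 Hb]]] := two Q2.
have [dc [Cc [dc0 Cc0 Hc]]] := two Q3; have [dd [Cd [dd0 Cd0 Hd]]] := two Q4.
exists (Num.min (Num.min da db) (Num.min dc dd)),
  (Num.max (Num.max Ca Cb) (Num.max Cc Cd)); split.
- by rewrite !lt_min da0 db0 dc0.
- by rewrite !le_max Ca0.
- by case=> i; [apply: quadraticW (Ha i)|apply: quadraticW (Hb i)|
    apply: quadraticW (Hc i)|apply: quadraticW (Hd i)];
    rewrite ?ge_min ?le_max lexx ?orbT.
Qed.

(** Over four quarter turns the axis ratios multiply to [kap ^ 4 = (b / c) ^ 2] and the angles add
    up to [2 * pi]. *)
Lemma Delta_expR (R : realType) (a : R) (b c : R -> R) (l : R) :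
  0 < b l -> 0 < c l -> Delta a b c l = expR (4 * quarter_exponent a b c l).
Proof.
move=> b0 c0; have k0 : 0 < b l / c l by rewrite divr_gt0.
rewrite /Delta /quarter_exponent.
have -> : 4 * (ln (Num.sqrt (b l / c l)) - a / Num.sqrt (b l * c l) * (pi / 2)) =
    ln (Num.sqrt (b l / c l)) *+ 4 + - (a / Num.sqrt (b l * c l)) * (2 * pi).
  have : Num.sqrt (b l * c l) != 0 by rewrite gt_eqF// sqrtr_gt0 mulr_gt0.
  by move: (Num.sqrt (b l * c l)) => s s0; rewrite -mulr_natl mulrBr; field.
rewrite expRD; congr (_ * _).
rewrite -lnXn ?sqrtr_gt0// lnK ?posrE ?exprn_gt0 ?sqrtr_gt0//.
by rewrite (exprM _ 2 2) sqr_sqrtr// ltW.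
Qed.

Lemma c1_at_constants (R : realType) (a : R) (b c : R -> R) :
  c1_at b 0 -> c1_at c 0 -> 0 < b 0 -> 0 < c 0 ->
  [/\ c1_at (fun l => Num.sqrt (b l * c l)) 0,
      c1_at (fun l => Num.sqrt (b l / c l)) 0 &
      c1_at (quarter_exponent a b c) 0].
Proof.
move=> b1 c1 b0 c0.
have om1 : c1_at (fun l => Num.sqrt (b l * c l)) 0.
  apply: (c1_at_comp (g := Num.sqrt)); first exact: c1_atM.
  by apply: c1_at_sqrt; rewrite mulr_gt0.
have kap1 : c1_at (fun l => Num.sqrt (b l / c l)) 0.
  apply: (c1_at_comp (g := Num.sqrt)).
    apply: c1_atM => //; apply: (c1_at_comp (g := GRing.inv)) => //.
    exact: c1_at_inv.
  by apply: c1_at_sqrt; rewrite divr_gt0.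
split=> //.
have -> : quarter_exponent a b c = fun l =>
    ln (Num.sqrt (b l / c l)) + (- a * (pi / 2)) * (Num.sqrt (b l * c l))^-1.
  by apply/funext => l; rewrite /quarter_exponent; ring.
apply: c1_atD.
  by apply: (c1_at_comp kap1); apply: c1_at_ln; rewrite sqrtr_gt0 divr_gt0.
apply: c1_atM; first exact: c1_at_cst.
by apply: (c1_at_comp om1); apply: c1_at_inv; rewrite sqrtr_gt0 mulr_gt0.
Qed.

Lemma equilibrium_periodic (R : realType) (f : quadrant -> 'cV[R]_2 -> 'cV[R]_2) :
  periodic_solution f (fun=> 0).
Proof.
split; last by exists 1.
split; first by move=> t; exact: cvg_cst.
  move=> u v; rewrite (_ : _ `&` _ = set0)//.
  by apply/seteqP; split=> // t [_ []]; rewrite eqxx.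
move=> t _; split=> [i|_]; last exact: is_derive_cst.
by case: i => /=; rewrite !mxE ltxx => -[].
Qed.

Theorem theorem3p1 (R : realType) (I : set R) (a : R) (b c : R -> R)
    (fbar : quadrant -> 'cV[R]_2 -> R -> 'cV[R]_2)
    (hI : open_interval_around0 I)
    (ha : 0 < a)
    (hb : forall l : R, I l -> 0 < b l)
    (hc : forall l : R, I l -> 0 < c l)
    (hb_smooth : smooth_on I b)
    (hc_smooth : smooth_on I c)
    (hfbar_analytic : forall (i : quadrant) (p : 'cV[R]_2) (l : R),
      I l -> analytic_at (fbar i) p l)
    (hfbar_o : forall (i : quadrant) (l : R), I l ->
      (fun x : 'cV[R]_2 => fbar i x l) =o_ (nbhs (0 : 'cV[R]_2)) id)
    (hDelta0 : Delta a b c 0 = 1)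
    (hDelta'0 : derive1 (Delta a b c) 0 != 0) :
  exists (J : set R) (lam : R -> R),
    open_interval_around0 J /\
    (forall x1 : R, J x1 -> I (lam x1)) /\
    {within J, continuous lam} /\
    lam 0 = 0 /\
    forall x1 : R, J x1 ->
      exists x : R -> 'cV[R]_2,
        periodic_solution (subsystem a b c fbar (lam x1)) x /\
        x 0 = col2 x1 0 /\
        (x1 = 0 -> forall t : R, x t = 0) /\
        (x1 <> 0 -> exists t : R, x t <> x 0).
Proof.
have [Io _ I0] := hI.
have b0 := hb _ I0; have c0 := hc _ I0.
have b1 := c1_at_smooth Io I0 hb_smooth; have c1 := c1_at_smooth Io I0 hc_smooth.
have [om1 kap1 D1] := c1_at_constants a b1 c1 b0 c0.
have [d1 d10 d1I] : exists2 d, 0 < d & forall l, `|l| <= d -> I l.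
  have /nbhs_normP[r /= r0 rI] : nbhs (0 : R) I by exact: open_nbhs_nbhs.
  exists (r / 2); first by rewrite divr_gt0.
  by move=> l ld; apply: rI => /=; rewrite sub0r normrN; lra.
have [d2 [C [d20 C0 fq]]] := common_quadratic d10 d1I hfbar_analytic hfbar_o.
have om0 : 0 < Num.sqrt (b 0 * c 0) by rewrite sqrtr_gt0 mulr_gt0.
have kap0 : 0 < Num.sqrt (b 0 / c 0) by rewrite sqrtr_gt0 divr_gt0.
have [d3 d30 om_lip] := c1_at_lip1 om1; have [d4 d40 kap_lip] := c1_at_lip1 kap1.
have [d5 d50 D_lip] := c1_at_lip1 D1.
have [d6 d60 om_ge] := c1_at_ge om1 om0; have [d7 d70 kap_ge] := c1_at_ge kap1 kap0.
pose E l := 4 * quarter_exponent a b c l.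
have E1 : c1_at E 0 by apply: c1_atM D1; exact: c1_at_cst.
have DeltaE l : `|l| <= d1 -> Delta a b c l = expR (E l).
  by move=> /d1I Il; rewrite Delta_expR ?hb ?hc.
have E0 : E 0 = 0.
  by apply: expR_inj; rewrite -DeltaE ?normr0 ?(ltW d10)// hDelta0 expR0.
have D0 : quarter_exponent a b c 0 = 0.
  by move/eqP: E0; rewrite mulf_eq0 pnatr_eq0 => /eqP.
pose d := derive1 E 0.
(* Since [E 0 = 0], the chain rule gives [Delta] the same derivative at [0] as its logarithm [E]. *)
have dn0 : d != 0.
  have := is_derive1_comp (is_derive_expR (E 0)) (c1_at_derive E1).
  rewrite E0 expR0 mul1r => DD.
  have {}DD : is_derive (0 : R) 1 (Delta a b c) d.
    apply: near_eq_is_derive DD; near=> l.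
    by rewrite DeltaE//; near: l; exact: nbhs0_le.
  by move: hDelta'0; rewrite derive1E; case: DD => _ ->.
have nd4 : 0 < `|d| / 4 by rewrite divr_gt0// normr_gt0.
have [d8 d80 strict] := c1_at_strict E1 nd4.
pose d0 := Num.min (Num.min (Num.min d1 d2) (Num.min d3 d4))
  (Num.min (Num.min d5 d6) (Num.min d7 d8)).
have d00 : 0 < d0 by rewrite !lt_min d10 d20 d30 d40 d50 d60 d70.
have [[l1 l2 l3 l4] [l5 l6 l7 l8]] :
    [/\ d0 <= d1, d0 <= d2, d0 <= d3 & d0 <= d4] /\
    [/\ d0 <= d5, d0 <= d6, d0 <= d7 & d0 <= d8].
  by rewrite /d0 !ge_min !lexx !orbT.
pose m := Num.min (Num.sqrt (b 0 * c 0) / 2) (Num.sqrt (b 0 / c 0) / 2).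
have m0 : 0 < m by rewrite lt_min !divr_gt0.
have m_om : m <= Num.sqrt (b 0 * c 0) / 2 by rewrite /m ge_min lexx.
have m_kap : m <= Num.sqrt (b 0 / c 0) / 2 by rewrite /m ge_min lexx orbT.
have branch q := @periodic_branch R a d0 m C b c fbar ha d00 m0 C0
  (fun l ld => hb _ (d1I l (le_trans ld l1)))
  (fun l ld => hc _ (d1I l (le_trans ld l1)))
  (fun l ld => le_trans m_om (om_ge l (le_trans ld l6)))
  (fun l ld => le_trans m_kap (kap_ge l (le_trans ld l7)))
  (lipW (lexx 0) l3 om_lip) (lipW (lexx 0) l4 kap_lip)
  (fun q i => quadraticW l2 (lexx C) (fq q i)) (lipW (lexx 0) l5 D_lip) d q dn0 D0.
have strict0 l l' : `|l| <= d0 -> `|l'| <= d0 ->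
    `|4 * quarter_exponent a b c l - 4 * quarter_exponent a b c l' - d * (l - l')| <=
    `|d| / 4 * `|l - l'|.
  by move=> ld l'd; apply: strict; rewrite subr0 (le_trans _ l8).
have [r4 [L4 [lam4 [r40 lam40 lam4d lam4L sol4]]]] := branch Q4 strict0.
have [r2 [L2 [lam2 [r20 lam20 lam2d lam2L sol2]]]] := branch Q2 strict0.
pose r := Num.min r4 r2.
have r0 : 0 < r by rewrite lt_min r40.
have [rr4 rr2] : r <= r4 /\ r <= r2 by rewrite /r !ge_min !lexx orbT.
pose pos x := clamp 0 r x.
have pos4 x : 0 <= pos x <= r4.
  by have /andP[-> h] := clamp_itv x (ltW r0); rewrite (le_trans h).
have pos2 x : 0 <= pos x <= r2.
  by have /andP[-> h] := clamp_itv x (ltW r0); rewrite (le_trans h).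
have posN x : x <= 0 -> pos x = 0.
  by move=> x0; rewrite /pos /clamp min_r ?max_l// (le_trans x0)// ltW.
have posP x : 0 <= x -> x <= r -> pos x = x.
  by move=> x0 xr; rewrite /pos clamp_id// x0.
(* At least one of [pos x] and [pos (- x)] is [0], where both branches vanish; the sum thus glues
   them and inherits their Lipschitz bounds without a case distinction on signs. *)
pose lam x := lam4 (pos x) + lam2 (pos (- x)).
have lamP x : 0 <= x -> lam x = lam4 (pos x).
  by move=> x0; rewrite /lam (posN (- x)) ?oppr_le0// lam20 addr0.
have lamN x : x <= 0 -> lam x = lam2 (pos (- x)).
  by move=> x0; rewrite /lam posN// lam40 add0r.
exists `](- r), r[%classic, lam; split.
  split; first exact: interval_open.
    exact: interval_is_interval.
  by rewrite /= in_itv/= oppr_lt0 r0.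
split.
  move=> x _; apply: d1I; apply: le_trans l1.
  have [x0|/ltW x0] := leP 0 x; first by rewrite lamP// lam4d.
  by rewrite lamN// lam2d.
split.
  apply: continuous_subspaceT; apply: (@lipschitz_cts _ _ (`|L4| + `|L2|)) => x y.
  rewrite /lam opprD addrACA (le_trans (ler_normD _ _))// mulrDl lerD//.
    apply: le_trans (lam4L _ _ (pos4 x) (pos4 y)) _.
    apply: le_trans (ler_wpM2r (normr_ge0 _) (ler_norm L4)) _.
    by rewrite ler_wpM2l//; exact: clamp_lip.
  apply: le_trans (lam2L _ _ (pos2 _) (pos2 _)) _.
  apply: le_trans (ler_wpM2r (normr_ge0 _) (ler_norm L2)) _.
  rewrite ler_wpM2l// (le_trans (clamp_lip 0 r (- x) (- y)))//.
  by rewrite -opprD normrN.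
split; first by rewrite lamP// posN// lam40.
move=> x1; rewrite /= in_itv/= => /andP[x1r1 x1r2].
have [x1n|x1p|->] := ltgtP x1 0.
- have x1r : - x1 <= r by rewrite lerNl ltW.
  have [|x [xp x0 xt]] := sol2 (- x1).
    by rewrite oppr_gt0 x1n (le_trans x1r).
  exists x; rewrite (lamN _ (ltW x1n)) posP ?oppr_ge0 ?(ltW x1n)//; split=> //.
  split; first by rewrite x0 /= opprK oppr0.
  by split=> [x10|//]; rewrite x10 ltxx in x1n.
- have x1r : x1 <= r by rewrite ltW.
  have [|x [xp x0 xt]] := sol4 x1; first by rewrite x1p (le_trans x1r).
  exists x; rewrite (lamP _ (ltW x1p)) posP ?(ltW x1p)//; split=> //.
  split; first by rewrite x0.
  by split=> [x10|//]; rewrite x10 ltxx in x1p.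
- exists (fun=> 0); split; first exact: equilibrium_periodic.
  split; last by split.
  by apply/matrixP => i j; rewrite !mxE; case: ifP.
Unshelve. all: by end_near. Qed.
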